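(* (Deadlock freedom.) Let $P$ be a process of the probabilistic multiparty session calculus with $\emptyset\vdash P\rhd\emptyset$, where $P\equiv(\nu s:G)\,\big(\prod_{i\in I}P_i\big)$ (parallel composition of the $P_i$), each $P_i$ interacts only on the channel $s[r_i]$, and $s[r_i]$ has type $T_i=G\upharpoonright r_i$. Then $P$ is deadlock-free: whenever $P\xrightarrow{tl_1}_{p_1}\cdots\xrightarrow{tl_n}_{p_n}P'$ ($n\ge0$) and $P'$ admits no transition, we have $P'\equiv\mathbf 0$.
   Context: Syntax. Fix session names $s$, roles $r$, labels $l$, variables $x$, process variables $X$, base values $v$ and base sorts $S$. Channels $c ::= x\mid s[r]$. Processes: $P,Q ::= c[r]\oplus_{i\in I}\langle p_i : l_i(v_i); P_i\rangle \mid c[r]\,\&_{i\in I}\{l_i(x_i);P_i\} \mid (\nu s)P \mid \mathsf{def}\ D\ \mathsf{in}\ P \mid X(\tilde v) \mid \mathbf 0 \mid P\mid Q$, $D ::= X(\tilde x)=P$ (closed declarations), $I\neq\emptyset$, labels pairwise distinct, $p_i\in[0,1]$, $x_i$ bound in $P_i$. $(\nu s:G)P$ is restriction annotated with a global type $G$. Evaluation contexts $\mathcal E$ are built from the hole by parallel composition with processes, restriction and process definition. $fc$, $dpv$, $fpv$: free channels with roles, declared process variables, free process variables. Structural congruence $\equiv$: least congruence with $P\mid Q\equiv Q\mid P$; $(P\mid Q)\mid R\equiv P\mid(Q\mid R)$; $P\mid\mathbf 0\equiv P$; $(\nu s)\mathbf 0\equiv\mathbf 0$; $(\nu s)(\nu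 s')P\equiv(\nu s')(\nu s)P$; $(\nu s)P\mid Q\equiv(\nu s)(P\mid Q)$ if $s\notin fc(Q)$; $\mathsf{def}\ D\ \mathsf{in}\ \mathbf 0\equiv\mathbf 0$; $\mathsf{def}\ D\ \mathsf{in}\ (\nu s)P\equiv(\nu s)\mathsf{def}\ D\ \mathsf{in}\ P$ if $s\notin fc(D)$; $\mathsf{def}\ D\ \mathsf{in}\ (P\mid Q)\equiv(\mathsf{def}\ D\ \mathsf{in}\ P)\mid Q$ if $dpv(D)\cap fpv(Q)=\emptyset$; $\mathsf{def}\ D\ \mathsf{in}\ \mathsf{def}\ D'\ \mathsf{in}\ P\equiv\mathsf{def}\ D'\ \mathsf{in}\ \mathsf{def}\ D\ \mathsf{in}\ P$ under disjointness of declared/free process variables. Operational semantics: (Com) $s[r_1][r_2]\oplus_{j\in J}\langle p_j:l_j(v_j);P_j\rangle\mid s[r_2][r_1]\&_{i\in I}\{l_i(x_i);P'_i\}\xrightarrow{(r_1,r_2,l_k)}_{p_k}P_k\mid P'_k\{v_k/x_k\}$ if $k\in J\subseteq I$; (Call) $\mathsf{def}\ X(\tilde x)=P\ \mathsf{in}\ (X(\tilde v)\mid Q)\xrightarrow{\varepsilon}_1\mathsf{def}\ X(\tilde x)=P\ \mathsf{in}\ (P\{\tilde v/\tilde x\}\mid Q)$; (Ctxt) $P\xrightarrow{tl}_pP'$ implies $\mathcal E[P]\xrightarrow{tl}_{p'}\mathcal E[P']$ (for a normalized probability $p'$); (Struct) transitions are closed under $\equiv$ on both sides. Types. Imprecise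 probability $\delta=[d_1,d_2]\subseteq[0,1]$. Global types $G ::= r_1\to r_2:\{\delta_i:l_i(S_i).G_i\}_{i\in I}\mid\mu t.G\mid t\mid\mathsf{end}$; local types $T ::= r\oplus_{i\in I}\delta_i:!l_i\langle S_i\rangle.T_i\mid r\,\&_{i\in I}?l_i(S_i).T_i\mid\mu t.T\mid t\mid\mathsf{end}$. Projection $G\upharpoonright r$: for $G=r_1\to r_2:\{\delta_i:l_i(S_i).G_i\}$ it is $r_1\oplus_i\delta_i:!l_i\langle S_i\rangle.(G_i\upharpoonright r)$ if $r=r_1\ne r_2$, $r_2\,\&_i?l_i(S_i).(G_i\upharpoonright r)$ if $r=r_2\ne r_1$, $G_1\upharpoonright r$ if $r\notin\{r_1,r_2\}$ and all $G_i\upharpoonright r$ coincide; $(\mu t.G)\upharpoonright r=\mu t.(G\upharpoonright r)$ if this is not $\mathsf{end}$, else $\mathsf{end}$; $t\upharpoonright r=t$; $\mathsf{end}\upharpoonright r=\mathsf{end}$; undefined otherwise. Global types are assumed well-formed: $G\upharpoonright r$ is defined for every role of $G$, and every family $\{\delta_i=[d_{1i},d_{2i}]\}_{i\in I}$ occurring in a type is reachable, i.e. $(\sum_{j\neq i}d_{1j})+d_{2i}\le1\le(\sum_{j\ne i}d_{2j})+d_{1i}$ for every $i$. Typing. Sortings $\Gamma ::= \emptyset\mid\Gamma,x:S\mid\Gamma,X:\tilde S\tilde T$; typings $\Delta ::= \emptyset\mid\Delta,\{s[r_i]:T_i\}_{i\in I}$; $\Delta,\Delta'$ is union with disjoint domains;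 ''$\Delta$ end only'': all types are $\mathsf{end}$. Rules: (TVar) $\Gamma,x:S\vdash x:S$; (TVal) $\Gamma\vdash v:S$; (TSelect) if $\forall i$: $\Gamma\vdash v_i:S_i$, $\Gamma\vdash P_i\rhd\Delta,c:T_i$, and $\sum_ip_i=1$, $p_i\in\delta_i$, then $\Gamma\vdash c[r]\oplus_{i\in I}\langle p_i:l_i(v_i);P_i\rangle\rhd\Delta,c:r\oplus_{i\in I}\delta_i:!l_i\langle S_i\rangle.T_i$; (TBranch) if $\forall i$: $\Gamma,x_i:S_i\vdash P_i\rhd\Delta,c:T_i$ then $\Gamma\vdash c[r]\&_{i\in I}\{l_i(x_i);P_i\}\rhd\Delta,c:r\&_{i\in I}?l_i(S_i).T_i$; (TEnd) $\Delta$ end only $\Rightarrow\Gamma\vdash\mathbf 0\rhd\Delta$; (TConc) $\Gamma\vdash P\rhd\Delta$, $\Gamma\vdash Q\rhd\Delta'$ $\Rightarrow\Gamma\vdash P\mid Q\rhd\Delta,\Delta'$; (TRes) for $(\nu s:G)P$: if $G$ has $|I|$ participants, $T_i=G\upharpoonright r_i$ for all $i$, and $\Gamma\vdash P\rhd\Delta,\{s[r_i]:T_i\}_{i\in I}$, then $\Gamma\vdash(\nu s:G)P\rhd\Delta$; (TDef) $\Gamma,\tilde x:\tilde S,X:\tilde ST_1\dots T_n\vdash P\rhd c_1:T_1,\dots,c_n:T_n$ and $\Gamma,X:\tilde ST_1\dots T_n\vdash Q\rhd\Delta$ $\Rightarrow\Gamma\vdash\mathsf{def}\ X(\tilde xc_1\dots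 c_n)=P\ \mathsf{in}\ Q\rhd\Delta$; (TCall) $\Gamma\vdash\tilde v:\tilde S$ and $\Delta$ end only $\Rightarrow\Gamma,X:\tilde ST_1\dots T_n\vdash X(\tilde vc_1\dots c_n)\rhd\Delta,c_1:T_1,\dots,c_n:T_n$. *)

(* Defs.v *)
(* [List] supplies [In], [NoDup] and [Permutation] for sequences over types
   without decidable equality; it comes first so that [seq]'s names prevail. *)
From Stdlib Require Import List Permutation.
From HB Require Import structures.
From mathcomp Require Import all_boot all_order all_algebra.
From mathcomp Require Import reals.

Set Implicit Arguments.
Unset Strict Implicit.
Unset Printing Implicit Defensive.

Import Order.TTheory GRing.Theory Num.Theory.
Local Open Scope ring_scope.

Definition role := nat.
Definition label := nat.

(* A family {l_i : a_i}_{i in I} with I nonempty and pairwise distinct labels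
   is a nonempty finite set of labelled items.  It is listed by strictly
   increasing label, so that two families are equal as sets iff the lists are
   equal, and "for all i in I" may be read as "for every label". *)
Definition wf_family (A : Type) (f : seq (label * A)%type) : bool :=
  ~~ nilp f && sorted ltn (unzip1 f).

(* Binders are de Bruijn indices, with four independent name spaces:
   sessions, base-value variables, channel variables, process variables. *)
Inductive chan := CVar of nat | CSess of nat & role.

Section Calculus.
Variables (R : realType) (bsort bval : Type) (has_sort : bval -> bsort -> Prop).

Definition iprob := (R * R)%type.

Definition in_iprob (p : R) (d : iprob) : bool := d.1 <= p <= d.2.

Definition wf_iprob (d : iprob) : bool := [&& 0 <= d.1, d.1 <= d.2 & d.2 <= 1].

Definition reachable (ds : seq iprob) : bool :=
  let d := tnth (in_tuple ds) in
  [forall i, (\sum_(j | j != i) (d j).1) + (d i).2 <= 1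
             <= (\sum_(j | j != i) (d j).2) + (d i).1].

Definition wf_iprobs (ds : seq iprob) : bool := all wf_iprob ds && reachable ds.

Inductive gtype :=
| GComm of role & role & seq (label * (iprob * bsort * gtype))
| GMu of gtype
| GVar of nat
| GEnd.

Inductive ltype :=
| LSel of role & seq (label * (iprob * bsort * ltype))
| LBra of role & seq (label * (bsort * ltype))
| LMu of ltype
| LVar of nat
| LEnd.

Fixpoint roles (G : gtype) : seq role :=
  match G with
  | GComm r1 r2 bs => r1 :: r2 :: flatten [seq roles b.2.2 | b <- bs]
  | GMu G => roles G
  | GVar _ | GEnd => [::]
  end.

(* [proj G r T] is "the projection of G onto r is defined and equal to T". *)
Inductive proj : gtype -> role -> ltype -> Prop :=
| proj_send r r2 bs ts :
    r != r2 ->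
    [seq (b.1, b.2.1) | b <- bs] = [seq (t.1, t.2.1) | t <- ts] ->
    (forall l d S G T, In (l, (d, S, G)) bs -> In (l, (d, S, T)) ts ->
       proj G r T) ->
    proj (GComm r r2 bs) r (LSel r2 ts)
| proj_recv r1 r bs ts :
    r != r1 ->
    [seq (b.1, b.2.1.2) | b <- bs] = [seq (t.1, t.2.1) | t <- ts] ->
    (forall l d S G T, In (l, (d, S, G)) bs -> In (l, (S, T)) ts ->
       proj G r T) ->
    proj (GComm r1 r bs) r (LBra r1 ts)
| proj_other r1 r2 r bs T :
    r != r1 -> r != r2 -> ~~ nilp bs ->
    (forall l d S G, In (l, (d, S, G)) bs -> proj G r T) ->
    proj (GComm r1 r2 bs) r T
| proj_mu G r T : proj G r T -> T <> LEnd -> proj (GMu G) r (LMu T)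
| proj_mu_end G r : proj G r LEnd -> proj (GMu G) r LEnd
| proj_var t r : proj (GVar t) r (LVar t)
| proj_end r : proj GEnd r LEnd.

Fixpoint wf_gfamilies (G : gtype) : bool :=
  match G with
  | GComm _ _ bs =>
      [&& wf_family bs, wf_iprobs [seq b.2.1.1 | b <- bs]
        & all (fun b => wf_gfamilies b.2.2) bs]
  | GMu G => wf_gfamilies G
  | GVar _ | GEnd => true
  end.

Definition wf_gtype (G : gtype) : Prop :=
  wf_gfamilies G /\ forall r, r \in roles G -> exists T, proj G r T.

Fixpoint wf_ltype (T : ltype) : bool :=
  match T with
  | LSel _ bs =>
      [&& wf_family bs, wf_iprobs [seq b.2.1.1 | b <- bs]
        & all (fun b => wf_ltype b.2.2) bs]
  | LBra _ bs => wf_family bs && all (fun b => wf_ltype b.2.2) bs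
  | LMu T => wf_ltype T
  | LVar _ | LEnd => true
  end.

Fixpoint lshift (k : nat) (T : ltype) : ltype :=
  match T with
  | LSel r bs => LSel r [seq (b.1, (b.2.1, lshift k b.2.2)) | b <- bs]
  | LBra r bs => LBra r [seq (b.1, (b.2.1, lshift k b.2.2)) | b <- bs]
  | LMu T => LMu (lshift k.+1 T)
  | LVar t => LVar (if (t < k)%N then t else t.+1)
  | LEnd => LEnd
  end.

Fixpoint lsubst (k : nat) (U T : ltype) : ltype :=
  match T with
  | LSel r bs => LSel r [seq (b.1, (b.2.1, lsubst k U b.2.2)) | b <- bs]
  | LBra r bs => LBra r [seq (b.1, (b.2.1, lsubst k U b.2.2)) | b <- bs]
  | LMu T => LMu (lsubst k.+1 (lshift 0 U) T)
  | LVar t => if (t < k)%N then LVar t else if t == k then U else LVar t.-1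
  | LEnd => LEnd
  end.

(* Local types are equi-recursive: [leqv] is the least congruence that
   identifies a recursive type with its unfolding. *)
Inductive leqv : ltype -> ltype -> Prop :=
| leqv_unfold T : leqv (LMu T) (lsubst 0 (LMu T) T)
| leqv_refl T : leqv T T
| leqv_sym T U : leqv T U -> leqv U T
| leqv_trans T U V : leqv T U -> leqv U V -> leqv T V
| leqv_sel r bs l d S T T' bs' : leqv T T' ->
    leqv (LSel r (bs ++ (l, (d, S, T)) :: bs'))
         (LSel r (bs ++ (l, (d, S, T')) :: bs'))
| leqv_bra r bs l S T T' bs' : leqv T T' ->
    leqv (LBra r (bs ++ (l, (S, T)) :: bs'))
         (LBra r (bs ++ (l, (S, T')) :: bs'))
| leqv_mu T T' : leqv T T' -> leqv (LMu T) (LMu T').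

Inductive expr := EVar of nat | EVal of bval.

(* [PDef m n B Q] is "def X(x_1..x_m, y_1..y_n) = B in Q" with base-value
   formals x and channel formals y: the i-th formal is index i of its name
   space in B, and X is process variable 0 in both B and Q.  In [PBra] each
   continuation binds base-value variable 0.  [PRes None P] is the plain
   restriction and [PRes (Some G) P] the annotated one; both bind session 0. *)
Inductive proc :=
| PSel of chan & role & seq (label * (R * expr * proc))
| PBra of chan & role & seq (label * proc)
| PRes of option gtype & proc
| PDef of nat & nat & proc & proc
| PCall of nat & seq expr & seq chan
| PNil
| PPar of proc & proc.

Section Substitution.

Definition lift_ren (n : nat) (rho : nat -> nat) (i : nat) : nat :=
  if (i < n)%N then i else (n + rho (i - n))%N.

Definition lift_expr (n : nat) (s : nat -> expr) (i : nat) : expr :=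
  if (i < n)%N then EVar i else
  if s (i - n)%N is EVar j then EVar (n + j) else s (i - n)%N.

Definition lift_chan (n : nat) (s : nat -> chan) (i : nat) : chan :=
  if (i < n)%N then CVar i else
  if s (i - n)%N is CVar j then CVar (n + j) else s (i - n)%N.

Definition subst_expr (se : nat -> expr) (e : expr) : expr :=
  if e is EVar i then se i else e.

Definition subst_chan (rs : nat -> nat) (sc : nat -> chan) (c : chan) : chan :=
  match c with CVar i => sc i | CSess s r => CSess (rs s) r end.

(* Simultaneous capture-avoiding renaming of sessions by [rs] and of process
   variables by [rX], and substitution of base-value variables by [se] and of
   channel variables by [sc]. *)
Fixpoint subst (rs : nat -> nat) (se : nat -> expr) (sc : nat -> chan)
    (rX : nat -> nat) (P : proc) : proc :=
  match P with
  | PSel c r bs =>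
      PSel (subst_chan rs sc c) r
        [seq (b.1, (b.2.1.1, subst_expr se b.2.1.2, subst rs se sc rX b.2.2))
           | b <- bs]
  | PBra c r bs =>
      PBra (subst_chan rs sc c) r
        [seq (b.1, subst rs (lift_expr 1 se) sc rX b.2) | b <- bs]
  | PRes oG P =>
      PRes oG (subst (lift_ren 1 rs) se (subst_chan S CVar \o sc) rX P)
  | PDef m n B Q =>
      PDef m n
        (subst rs (lift_expr m se) (lift_chan n sc) (lift_ren 1 rX) B)
        (subst rs se sc (lift_ren 1 rX) Q)
  | PCall X vs cs =>
      PCall (rX X) (map (subst_expr se) vs) (map (subst_chan rs sc) cs)
  | PNil => PNil
  | PPar P Q => PPar (subst rs se sc rX P) (subst rs se sc rX Q)
  end.

End Substitution.

Definition ren_sess (rho : nat -> nat) : proc -> proc := subst rho EVar CVar id.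
Definition ren_pvar (rho : nat -> nat) : proc -> proc := subst id EVar CVar rho.

Definition inst_expr (vs : seq expr) (i : nat) : expr :=
  nth (EVar (i - size vs)) vs i.
Definition inst_chan (cs : seq chan) (i : nat) : chan :=
  nth (CVar (i - size cs)) cs i.
Definition inst (vs : seq expr) (cs : seq chan) : proc -> proc :=
  subst id (inst_expr vs) (inst_chan cs) id.

Definition swap01 (i : nat) : nat :=
  match i with 0 => 1 | 1 => 0 | _ => i end%N.

Definition scoped_expr (nb : nat) (e : expr) : bool :=
  if e is EVar i then (i < nb)%N else true.

Definition scoped_chan (ns nc : nat) (c : chan) : bool :=
  match c with CVar i => (i < nc)%N | CSess s _ => (s < ns)%N end.

(* The free sessions, base-value variables and channel variables of P are
   below [ns], [nb] and [nc]; process variables are unrestricted. *)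
Fixpoint scoped (ns nb nc : nat) (P : proc) : bool :=
  match P with
  | PSel c _ bs =>
      scoped_chan ns nc c &&
      all (fun b => scoped_expr nb b.2.1.2 && scoped ns nb nc b.2.2) bs
  | PBra c _ bs =>
      scoped_chan ns nc c && all (fun b => scoped ns nb.+1 nc b.2) bs
  | PRes _ P => scoped ns.+1 nb nc P
  | PDef m n B Q => scoped ns (m + nb) (n + nc) B && scoped ns nb nc Q
  | PCall _ vs cs => all (scoped_expr nb) vs && all (scoped_chan ns nc) cs
  | PNil => true
  | PPar P Q => scoped ns nb nc P && scoped ns nb nc Q
  end.

(* A declaration is closed if its body has no free channel and no free
   variable besides its formals; it may call process variables declared
   further out. *)
Definition closed_decl (m n : nat) (B : proc) : bool := scoped 0 m n B.

Definition wf_annot (oG : option gtype) : Prop :=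
  if oG is Some G then wf_gtype G else True.

Inductive wf_proc : proc -> Prop :=
| wf_PSel c r bs :
    wf_family bs ->
    (forall l p e P, In (l, (p, e, P)) bs -> 0 <= p <= 1) ->
    (forall l p e P, In (l, (p, e, P)) bs -> wf_proc P) ->
    wf_proc (PSel c r bs)
| wf_PBra c r bs :
    wf_family bs ->
    (forall l P, In (l, P) bs -> wf_proc P) ->
    wf_proc (PBra c r bs)
| wf_PRes oG P : wf_annot oG -> wf_proc P -> wf_proc (PRes oG P)
| wf_PDef m n B Q :
    closed_decl m n B -> wf_proc B -> wf_proc Q -> wf_proc (PDef m n B Q)
| wf_PCall X vs cs : wf_proc (PCall X vs cs)
| wf_PNil : wf_proc PNil
| wf_PPar P Q : wf_proc P -> wf_proc Q -> wf_proc (PPar P Q).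

(* The freshness side conditions are built in: a process that must not mention
   a binder appears as the shift of a process living outside that binder.  The
   two rules that erase a binder carry well-formedness premises so that,
   read from right to left, they introduce only well-formed syntax. *)
Inductive scong : proc -> proc -> Prop :=
| sc_par_comm P Q : scong (PPar P Q) (PPar Q P)
| sc_par_assoc P Q U : scong (PPar (PPar P Q) U) (PPar P (PPar Q U))
| sc_par_nil P : scong (PPar P PNil) P
| sc_res_nil oG : wf_annot oG -> scong (PRes oG PNil) PNil
| sc_res_res oG oG' P :
    scong (PRes oG (PRes oG' P)) (PRes oG' (PRes oG (ren_sess swap01 P)))
| sc_res_par oG P Q :
    scong (PPar (PRes oG P) Q) (PRes oG (PPar P (ren_sess S Q)))
| sc_def_nil m n B :
    closed_decl m n B -> wf_proc B -> scong (PDef m n B PNil) PNil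
| sc_def_res m n B oG P :
    scong (PDef m n B (PRes oG P)) (PRes oG (PDef m n (ren_sess S B) P))
| sc_def_par m n B P Q :
    scong (PDef m n B (PPar P (ren_pvar S Q))) (PPar (PDef m n B P) Q)
| sc_def_def m n B m' n' B' P :
    scong (PDef m n B (PDef m' n' (ren_pvar (lift_ren 1 S) B') P))
          (PDef m' n' B' (PDef m n (ren_pvar (lift_ren 1 S) B)
                            (ren_pvar swap01 P)))
| sc_refl P : scong P P
| sc_sym P Q : scong P Q -> scong Q P
| sc_trans P Q U : scong P Q -> scong Q U -> scong P U
| sc_sel c r bs l p e P P' bs' : scong P P' ->
    scong (PSel c r (bs ++ (l, (p, e, P)) :: bs'))
          (PSel c r (bs ++ (l, (p, e, P')) :: bs'))
| sc_bra c r bs l P P' bs' : scong P P' ->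
    scong (PBra c r (bs ++ (l, P) :: bs')) (PBra c r (bs ++ (l, P') :: bs'))
| sc_res oG P P' : scong P P' -> scong (PRes oG P) (PRes oG P')
| sc_def m n B B' Q Q' : scong B B' -> scong Q Q' ->
    scong (PDef m n B Q) (PDef m n B' Q')
| sc_par P P' Q Q' : scong P P' -> scong Q Q' ->
    scong (PPar P Q) (PPar P' Q').

Inductive ectx :=
| EHole
| EParL of ectx & proc
| EParR of proc & ectx
| ERes of option gtype & ectx
| EDef of nat & nat & proc & ectx.

Fixpoint fill (E : ectx) (P : proc) : proc :=
  match E with
  | EHole => P
  | EParL E Q => PPar (fill E P) Q
  | EParR Q E => PPar Q (fill E P)
  | ERes oG E => PRes oG (fill E P)
  | EDef m n B E => PDef m n B (fill E P)
  end.

(* [Some (r1, r2, l)] is a communication label, [None] is epsilon. *)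
Definition tlabel := option (role * role * label).

(* [norm E P p] is the normalized probability of a transition of [fill E P]
   that is inherited from a transition of P of probability p. *)
Inductive step (norm : ectx -> proc -> R -> R) :
    proc -> tlabel -> R -> proc -> Prop :=
| step_com s r1 r2 bs bs' l p v P P' :
    {subset unzip1 bs <= unzip1 bs'} ->
    In (l, (p, v, P)) bs -> In (l, P') bs' ->
    step norm (PPar (PSel (CSess s r1) r2 bs) (PBra (CSess s r2) r1 bs'))
      (Some (r1, r2, l)) p (PPar P (inst [:: v] [::] P'))
| step_call m n B vs cs Q :
    size vs = m -> size cs = n ->
    step norm (PDef m n B (PPar (PCall 0 vs cs) Q))
      None 1 (PDef m n B (PPar (inst vs cs B) Q))
| step_ctxt E P tl p P' :
    step norm P tl p P' -> step norm (fill E P) tl (norm E P p) (fill E P')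
| step_struct P Q tl p Q' P' :
    scong P Q -> step norm Q tl p Q' -> scong Q' P' -> step norm P tl p P'.

Inductive steps (norm : ectx -> proc -> R -> R) : proc -> proc -> Prop :=
| steps_refl P : steps norm P P
| steps_step P tl p Q P' :
    step norm P tl p Q -> steps norm Q P' -> steps norm P P'.

Definition deadlock_free (norm : ectx -> proc -> R -> R) (P : proc) : Prop :=
  forall P', steps norm P P' ->
    (forall tl p Q, ~ step norm P' tl p Q) -> scong P' PNil.

Definition typing := seq (chan * ltype).

Definition disjoint_domains (D : typing) : Prop := NoDup (unzip1 D).

Definition end_only (D : typing) : Prop := forall c T, In (c, T) D -> T = LEnd.

Definition shift_typing (D : typing) : typing :=
  [seq (subst_chan S CVar cT.1, cT.2) | cT <- D].

Inductive has_type_expr (Gb : seq bsort) : expr -> bsort -> Prop :=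
| TVar x S : onth Gb x = Some S -> has_type_expr Gb (EVar x) S
| TVal v S : has_sort v S -> has_type_expr Gb (EVal v) S.

(* The sorting is split into the sorts [Gb] of the base-value variables and
   the signatures [Gp] of the process variables.  Typings are finite maps from
   channels to types: association lists without repeated keys ([TExch]).
   [TEqui] identifies types up to [leqv]. *)
Inductive has_type :
    seq bsort -> seq (seq bsort * seq ltype) -> proc -> typing -> Prop :=
| TSelect Gb Gp c r (bs : seq (label * (R * expr * proc))) ts D :
    unzip1 bs = unzip1 ts ->
    wf_ltype (LSel r ts) ->
    (forall l p v P d S T, In (l, (p, v, P)) bs -> In (l, (d, S, T)) ts ->
       has_type_expr Gb v S) ->
    (forall l p v P d S T, In (l, (p, v, P)) bs -> In (l, (d, S, T)) ts ->
       has_type Gb Gp P ((c, T) :: D)) ->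
    \sum_(b <- bs) b.2.1.1 = 1 ->
    (forall l p v P d S T, In (l, (p, v, P)) bs -> In (l, (d, S, T)) ts ->
       in_iprob p d) ->
    has_type Gb Gp (PSel c r bs) ((c, LSel r ts) :: D)
| TBranch Gb Gp c r (bs : seq (label * proc)) ts D :
    unzip1 bs = unzip1 ts ->
    wf_ltype (LBra r ts) ->
    (forall l P S T, In (l, P) bs -> In (l, (S, T)) ts ->
       has_type (S :: Gb) Gp P ((c, T) :: D)) ->
    has_type Gb Gp (PBra c r bs) ((c, LBra r ts) :: D)
| TEnd Gb Gp D :
    disjoint_domains D -> end_only D -> has_type Gb Gp PNil D
| TConc Gb Gp P Q D D' :
    disjoint_domains (D ++ D') ->
    has_type Gb Gp P D -> has_type Gb Gp Q D' ->
    has_type Gb Gp (PPar P Q) (D ++ D')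
| TRes Gb Gp G P D (rTs : seq (role * ltype)) :
    wf_gtype G ->
    uniq (unzip1 rTs) -> unzip1 rTs =i roles G ->
    (forall r T, In (r, T) rTs -> proj G r T) ->
    has_type Gb Gp P
      (shift_typing D ++ [seq (CSess 0 rT.1, rT.2) | rT <- rTs]) ->
    has_type Gb Gp (PRes (Some G) P) D
| TDef Gb Gp m n B Q Ss Ts D :
    size Ss = m -> size Ts = n -> all wf_ltype Ts ->
    has_type (Ss ++ Gb) ((Ss, Ts) :: Gp) B
      (zip [seq CVar i | i <- iota 0 n] Ts) ->
    has_type Gb ((Ss, Ts) :: Gp) Q D ->
    has_type Gb Gp (PDef m n B Q) D
| TCall Gb Gp X Ss Ts vs cs D :
    onth Gp X = Some (Ss, Ts) ->
    size vs = size Ss -> size cs = size Ts ->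
    (forall v S, In (v, S) (zip vs Ss) -> has_type_expr Gb v S) ->
    end_only D -> disjoint_domains (D ++ zip cs Ts) ->
    has_type Gb Gp (PCall X vs cs) (D ++ zip cs Ts)
| TExch Gb Gp P D D' :
    Permutation D D' -> has_type Gb Gp P D -> has_type Gb Gp P D'
| TEqui Gb Gp P c T T' D :
    leqv T T' -> has_type Gb Gp P ((c, T) :: D) ->
    has_type Gb Gp P ((c, T') :: D).

Definition chan_only_on (s : nat) (r : role) (c : chan) : bool :=
  match c with CVar _ => true | CSess s' r' => (s' == s) && (r' == r) end.

(* P interacts only on s[r]: s[r] is the only channel with role occurring in P,
   whether free or of a session restricted inside P.  Channel variables are
   admitted: in a process without free ones they are formals of declarations,
   to which calls can only pass s[r]. *)
Fixpoint only_on (s : nat) (r : role) (P : proc) : bool :=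
  match P with
  | PSel c _ bs => chan_only_on s r c && all (fun b => only_on s r b.2.2) bs
  | PBra c _ bs => chan_only_on s r c && all (fun b => only_on s r b.2) bs
  | PRes _ P => only_on s.+1 r P
  | PDef _ _ B Q => only_on s r B && only_on s r Q
  | PCall _ _ cs => all (chan_only_on s r) cs
  | PNil => true
  | PPar P Q => only_on s r P && only_on s r Q
  end.

End Calculus.

Arguments GVar {R bsort}.
Arguments GEnd {R bsort}.
Arguments LVar {R bsort}.
Arguments LEnd {R bsort}.
Arguments EVar {bval}.
Arguments PCall {R bsort bval}.
Arguments PNil {R bsort bval}.
Arguments EHole {R bsort bval}.

(* Main.v *)
(* A local type is read as the infinite tree obtained by unfolding it, so that
   [leqv] becomes equality of trees; a global type is read as the tree of its
   communications, and projection as a coinductive relation between a global tree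
   and a local one.  A family of local trees is coherent when it is the projection
   of one global tree.  Coherence survives a communication, even out of order:
   delete the first occurrence of that communication along every path of the
   global tree.  If some tree of a coherent family starts with a send or a
   receive, then the root of the global tree is a communication, and its sender
   and receiver are ready for each other.

   Processes are typed against such trees, each prefix owning exactly one channel,
   which is what "interacting on a single [s[r]]" amounts to.  This typing is
   invariant under structural congruence in both directions and under reduction.
   A process is congruent to a prenex one, binders around a parallel composition
   of prefixes and calls.  A call can be moved next to its declaration and fires.
   Without calls, any prefix has its channel bound by some restriction, whose
   coherent family provides a matching pair of prefixes; with no prefix left, the
   process is congruent to [PNil]. *)
From Stdlib Require List Permutation.
Require Import Defs.
From HB Require Import structures.
From mathcomp Require Import all_boot all_order all_algebra.
From mathcomp Require Import reals boolp zify.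

Set Implicit Arguments.
Unset Strict Implicit.
Unset Printing Implicit Defensive.

(** * Local types as trees *)

(* [fintype] also has an [lshift]. *)
Local Notation lshift := Defs.lshift.

(** The relation [has_type] is not itself stable along reductions: a communication leaves the
    annotation of its restriction as it was, and structural congruence can introduce a restriction
    without annotation or a declaration whose body has no type. So the invariant asks only that some
    coherent family exists, and the family is chosen anew after each step. Communications out of
    order are the reason for trees. Congruence can bring together two prefixes whose communication
    lies below the root of the global type, behind communications of other roles and behind
    recursion. Removing it from a finite type would require unfolding on the way and a new proof of
    projectability; on functions from paths to roots it is a plain recursion on the path. Ownership
    of a single channel excludes cycles of waiting between sessions: a prefix can only be guarded by
    prefixes on the same channel. Hence, once no call is left, an action at the root of a tree
    belongs to a prefix that stands unguarded in the process. *)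

Lemma map_ext_In (A B : Type) (f g : A -> B) s :
  (forall x, List.In x s -> f x = g x) -> map f s = map g s.
Proof.
elim: s => //= x s IH fg; rewrite fg; last by left.
by rewrite IH // => y ys; apply: fg; right.
Qed.

Lemma In_cat (A : Type) (x : A) s t :
  List.In x (s ++ t) <-> List.In x s \/ List.In x t.
Proof. by elim: s => [|y s IH] /=; tauto. Qed.

Fixpoint assoc (A : Type) (l : label) (s : seq (label * A)) : option A :=
  if s is b :: s' then if b.1 == l then Some b.2 else assoc l s' else None.

Lemma assoc_map (A B : Type) (f : A -> B) l (s : seq (label * A)) :
  assoc l [seq (b.1, f b.2) | b <- s] = omap f (assoc l s).
Proof. by elim: s => //= b s ->; case: eqP. Qed.

Lemma assoc_In (A : Type) l (s : seq (label * A)) a :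
  assoc l s = Some a -> List.In (l, a) s.
Proof.
elim: s => //= -[l' b] s IH /=; case: eqP => [-> [->]|_ /IH]; first by left.
by right.
Qed.

Lemma assoc_unzip1 (A : Type) l (s : seq (label * A)) :
  l \in unzip1 s -> exists a, assoc l s = Some a.
Proof.
elim: s => //= -[l' b] s IH; rewrite inE /= eq_sym; case: eqP => /= [_ _|_ /IH //].
by exists b.
Qed.

Lemma In_unzip1 (A : Type) l (s : seq (label * A)) a :
  List.In (l, a) s -> l \in unzip1 s.
Proof.
by elim: s => //= -[l' b] s IH [[-> _]|/IH]; rewrite inE ?eqxx //= => ->; rewrite orbT.
Qed.

Lemma assoc_eq_map (A B C : Type) (f : A -> C) (g : B -> C) l
    (s : seq (label * A)) (t : seq (label * B)) a :
  [seq (b.1, f b.2) | b <- s] = [seq (b.1, g b.2) | b <- t] ->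
  assoc l s = Some a -> exists2 b, assoc l t = Some b & g b = f a.
Proof.
move=> e sa; move: (assoc_map g l t); rewrite -e assoc_map sa /=.
by case: (assoc l t) => // b [e']; exists b.
Qed.

Lemma unzip1_map (A B : Type) (f : A -> B) (s : seq (label * A)) :
  unzip1 [seq (b.1, f b.2) | b <- s] = unzip1 s.
Proof. by rewrite /unzip1 -map_comp. Qed.

Lemma unzip1_eq_map (A B C : Type) (f : A -> C) (g : B -> C)
    (s : seq (label * A)) (t : seq (label * B)) :
  [seq (b.1, f b.2) | b <- s] = [seq (b.1, g b.2) | b <- t] -> unzip1 s = unzip1 t.
Proof. by move=> e; rewrite -(unzip1_map f) e unzip1_map. Qed.

(* The root of a local type seen as an infinite tree.  [LEnd] and types that
   unfold forever have no root: a channel of such a type is never used by a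
   prefix, which is all that matters for progress. *)
Inductive head := HSel of role & seq label | HBra of role & seq label | HVar of nat.

Local Ltac var_cases :=
  repeat match goal with |- context [if ?b then _ else _] =>
    lazymatch b with context [if _ then _ else _] => fail
    | _ => case: (boolP b) => ? /= end
  end;
  try first [by [] | by congr LVar; lia | by exfalso; lia].

Section LocalTrees.
Variables (R : realType) (bsort : Type).
Notation ltype := (ltype R bsort).

Lemma ltype_ind_In (P : ltype -> Prop) :
  (forall r bs, (forall b, List.In b bs -> P b.2.2) -> P (LSel r bs)) ->
  (forall r bs, (forall b, List.In b bs -> P b.2.2) -> P (LBra r bs)) ->
  (forall T, P T -> P (LMu T)) ->
  (forall t, P (LVar t)) ->
  P LEnd -> forall T, P T.
Proof.
move=> hs hb hm hv he; fix IH 1 => -[r bs|r bs|T|t|].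
- apply: hs; elim: bs => [|[l [d T]] bs IHbs] b; first by case.
  by case=> [<- /=|/IHbs]; [exact: IH T | apply].
- apply: hb; elim: bs => [|[l [d T]] bs IHbs] b; first by case.
  by case=> [<- /=|/IHbs]; [exact: IH T | apply].
- exact/hm/IH.
- exact: hv.
- exact: he.
Qed.

Lemma lshift_lshift i k (T : ltype) : (i <= k)%N ->
  lshift k.+1 (lshift i T) = lshift i (lshift k T).
Proof.
elim/ltype_ind_In: T i k => [r bs IH|r bs IH|T IH|t|] i k ik //=.
- by rewrite -!map_comp; congr LSel; apply: map_ext_In => b bb /=; rewrite IH.
- by rewrite -!map_comp; congr LBra; apply: map_ext_In => b bb /=; rewrite IH.
- by rewrite IH.
- congr LVar; case: (ltnP t i) => ti; case: (ltnP t k) => tk /=;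
    do ![case: ifP => ? //=]; lia.
Qed.

Lemma lsubst_lshift k U (T : ltype) : lsubst k U (lshift k T) = T.
Proof.
elim/ltype_ind_In: T k U => [r bs IH|r bs IH|T IH|t|] k U //=.
- rewrite -!map_comp; congr LSel; rewrite -[RHS]map_id.
  by apply: map_ext_In => -[l [d T]] bb /=; rewrite (IH _ bb).
- rewrite -!map_comp; congr LBra; rewrite -[RHS]map_id.
  by apply: map_ext_In => -[l [d T]] bb /=; rewrite (IH _ bb).
- by rewrite IH.
- case: (ltnP t k) => [->//|kt]; rewrite ltnNge leqW //=.
  by case: eqP => // e; move: kt; rewrite -e ltnn.
Qed.

Lemma lshift_lsubst i k U (T : ltype) : (i <= k)%N ->
  lshift i (lsubst k U T) = lsubst k.+1 (lshift i U) (lshift i T).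
Proof.
elim/ltype_ind_In: T i k U => [r bs IH|r bs IH|T IH|t|] i k U ik //=.
- by rewrite -!map_comp; congr LSel; apply: map_ext_In => b bb /=; rewrite IH.
- by rewrite -!map_comp; congr LBra; apply: map_ext_In => b bb /=; rewrite IH.
- by rewrite IH // lshift_lshift.
- var_cases.
Qed.

(** For [i = 0] and [V = LMu T] this says that unfolding commutes with substitution, which is how it
    is used below. *)
Lemma lsubst_lsubst i k U V (T : ltype) : (i <= k)%N ->
  lsubst k U (lsubst i V T) =
  lsubst i (lsubst k U V) (lsubst k.+1 (lshift i U) T).
Proof.
elim/ltype_ind_In: T i k U V => [r bs IH|r bs IH|T IH|t|] i k U V ik //=.
- by rewrite -!map_comp; congr LSel; apply: map_ext_In => b bb /=; rewrite IH.
- by rewrite -!map_comp; congr LBra; apply: map_ext_In => b bb /=; rewrite IH.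
- by rewrite IH // lshift_lsubst // lshift_lshift.
- var_cases; by rewrite lsubst_lshift.
Qed.

(* [obs n T p h]: the subtree of [T] at the path [p] has root [h], and [n] recursive
   types are unfolded on the way.  The count makes [obs_mu_congr] an induction. *)
Inductive obs : nat -> ltype -> seq label -> head -> Prop :=
| obs_sel r bs : obs 0 (LSel r bs) [::] (HSel r (unzip1 bs))
| obs_bra r bs : obs 0 (LBra r bs) [::] (HBra r (unzip1 bs))
| obs_var t : obs 0 (LVar t) [::] (HVar t)
| obs_sel_cons n r bs l b p h :
    assoc l bs = Some b -> obs n b.2 p h -> obs n (LSel r bs) (l :: p) h
| obs_bra_cons n r bs l b p h :
    assoc l bs = Some b -> obs n b.2 p h -> obs n (LBra r bs) (l :: p) h
| obs_mu n T p h : obs n (lsubst 0 (LMu T) T) p h -> obs n.+1 (LMu T) p h.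

Lemma obs_selE n r bs p h : obs n (LSel r bs) p h ->
  p = [::] /\ h = HSel r (unzip1 bs) \/
  exists l b p', [/\ p = l :: p', assoc l bs = Some b & obs n b.2 p' h].
Proof. by move=> o; inversion o; subst; [left|right; exists l, b, p0]. Qed.

Lemma obs_braE n r bs p h : obs n (LBra r bs) p h ->
  p = [::] /\ h = HBra r (unzip1 bs) \/
  exists l b p', [/\ p = l :: p', assoc l bs = Some b & obs n b.2 p' h].
Proof. by move=> o; inversion o; subst; [left|right; exists l, b, p0]. Qed.

Lemma obs_muE n T p h : obs n (LMu T) p h ->
  exists2 m, n = m.+1 & obs m (lsubst 0 (LMu T) T) p h.
Proof. by move=> o; inversion o; subst; exists n0. Qed.

Lemma obs_varE n t p h : obs n (LVar t) p h -> p = [::] /\ h = HVar t.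
Proof. by move=> o; inversion o. Qed.

Lemma obs_inj n m T p h h' : obs n T p h -> obs m T p h' -> h = h'.
Proof.
move=> o; elim: o m h' => {n T p h}
  [r bs|r bs|t|n r bs l b p h e _ IH|n r bs l b p h e _ IH|n T p h _ IH] m h'.
- by case/obs_selE => [[_ ->]//|[? [? [? []]]]].
- by case/obs_braE => [[_ ->]//|[? [? [? []]]]].
- by case/obs_varE.
- case/obs_selE => [[//]|[l' [b' [p' [[<- <-]]]]]].
  by rewrite e => -[<-] /IH.
- case/obs_braE => [[//]|[l' [b' [p' [[<- <-]]]]]].
  by rewrite e => -[<-] /IH.
- by case/obs_muE => k _ /IH.
Qed.

(** Substitution for [k] removes that index, so larger variables move down. The head [HVar k] is
    excluded wherever this is used: there the path continues in the substituted type. *)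
Definition head_subst (k : nat) (h : head) : head :=
  if h is HVar t then HVar (if (t < k)%N then t else t.-1) else h.

(** The bound [m2 <= n] is what [obs_mu_congr] needs: the part of the path that continues in [U]
    costs no more unfoldings than the whole. The outer induction on the count serves [LMu], whose
    unfolding is not a subterm; the inner one on [T] serves prefixes, which cost no unfolding. *)
Lemma obs_lsubst n k U T p h : obs n (lsubst k U T) p h ->
  (exists m h0, [/\ obs m T p h0, h0 <> HVar k & h = head_subst k h0]) \/
  (exists p1 p2 m1 m2,
     [/\ p = p1 ++ p2, obs m1 T p1 (HVar k), obs m2 U p2 h & (m2 <= n)%N]).
Proof.
have [N] := ubnP n; elim: N n k U T p h => // N IHN n k U T p h nN.
elim/ltype_ind_In: T k U p n nN => [r bs IH|r bs IH|T _|t|] k U p n nN /= o.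
- case/obs_selE: o => [[-> ->]|[l [b [p' [->]]]]].
    left; exists 0%N, (HSel r (unzip1 bs)).
    by split=> //; [exact: obs_sel | rewrite (unzip1_map (fun b => (b.1, lsubst k U b.2)))].
  rewrite (assoc_map (fun b => (b.1, lsubst k U b.2))).
  case e: (assoc l bs) => [[dS T]|] //= -[<-] /= o.
  case: (IH (l, (dS, T)) (assoc_In e) _ _ _ _ nN o).
    move=> [m [h0 [o0 hk eh]]]; left; exists m, h0; split=> //.
    exact: obs_sel_cons e o0.
  move=> [p1 [p2 [m1 [m2 [-> o1 o2 m2n]]]]]; right.
  exists (l :: p1), p2, m1, m2; split=> //; exact: obs_sel_cons e o1.
- case/obs_braE: o => [[-> ->]|[l [b [p' [->]]]]].
    left; exists 0%N, (HBra r (unzip1 bs)).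
    by split=> //; [exact: obs_bra | rewrite (unzip1_map (fun b => (b.1, lsubst k U b.2)))].
  rewrite (assoc_map (fun b => (b.1, lsubst k U b.2))).
  case e: (assoc l bs) => [[dS T]|] //= -[<-] /= o.
  case: (IH (l, (dS, T)) (assoc_In e) _ _ _ _ nN o).
    move=> [m [h0 [o0 hk eh]]]; left; exists m, h0; split=> //.
    exact: obs_bra_cons e o0.
  move=> [p1 [p2 [m1 [m2 [-> o1 o2 m2n]]]]]; right.
  exists (l :: p1), p2, m1, m2; split=> //; exact: obs_bra_cons e o1.
- case/obs_muE: o nN => n' ->; rewrite -[LMu _]/(lsubst k U (LMu T)).
  rewrite -lsubst_lsubst // => o' nN; case: (IHN n' k U _ p h nN o').
    move=> [m [h0 [o0 hk eh]]]; left; exists m.+1, h0; split=> //.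
    exact: obs_mu.
  move=> [p1 [p2 [m1 [m2 [ep o1 o2 m2n]]]]]; right.
  exists p1, p2, m1.+1, m2; split=> //; [exact: obs_mu | exact: leqW].
- move: o; case: ltngtP => tk o; last first.
    by right; exists [::], p, 0%N, n; split=> //; rewrite tk; exact: obs_var.
  + left; exists 0%N, (HVar t); case/obs_varE: o => -> ->; split; [exact: obs_var| |].
      by case=> e; rewrite e ltnn in tk.
    by rewrite /= ltnNge ltnW.
  + left; exists 0%N, (HVar t); case/obs_varE: o => -> ->; split; [exact: obs_var| |].
      by case=> e; rewrite e ltnn in tk.
    by rewrite /= tk.
- by inversion o.
Qed.

Lemma obs_lsubst_head n k U T p h : obs n T p h -> h <> HVar k ->
  exists m, obs m (lsubst k U T) p (head_subst k h).
Proof.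
move=> o; elim: o k U => {n T p h}
  [r bs|r bs|t|n r bs l b p h e o IH|n r bs l b p h e o IH|n T p h o IH] k U hk /=.
- by exists 0%N; rewrite -(unzip1_map (fun b => (b.1, lsubst k U b.2)) bs); exact: obs_sel.
- by exists 0%N; rewrite -(unzip1_map (fun b => (b.1, lsubst k U b.2)) bs); exact: obs_bra.
- exists 0%N; case: ltngtP hk => [_ _|_ _|->]; [exact: obs_var|exact: obs_var|by []].
- have [m o'] := IH k U hk; exists m.
  apply: (obs_sel_cons _ (b := (b.1, lsubst k U b.2)) _ o').
  by rewrite (assoc_map (fun b => (b.1, lsubst k U b.2))) e.
- have [m o'] := IH k U hk; exists m.
  apply: (obs_bra_cons _ (b := (b.1, lsubst k U b.2)) _ o').
  by rewrite (assoc_map (fun b => (b.1, lsubst k U b.2))) e.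
- have [m o'] := IH k U hk; exists m.+1; apply: obs_mu.
  by rewrite -[LMu _]/(lsubst k U (LMu T)) -lsubst_lsubst.
Qed.

Lemma obs_lsubst_var n n' k U T p1 p2 h : obs n T p1 (HVar k) -> obs n' U p2 h ->
  exists m, obs m (lsubst k U T) (p1 ++ p2) h.
Proof.
move ehv: (HVar k) => hv o; elim: o ehv => {n T p1 hv}
  [r bs|r bs|t|n r bs l b p h' e o IH|n r bs l b p h' e o IH|n T p h' o IH] //=.
- by case=> <- oU; exists n'; rewrite ltnn eqxx.
- move=> ek oU; have [m o'] := IH ek oU; exists m.
  apply: (obs_sel_cons _ (b := (b.1, lsubst k U b.2)) _ o').
  by rewrite (assoc_map (fun b => (b.1, lsubst k U b.2))) e.
- move=> ek oU; have [m o'] := IH ek oU; exists m.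
  apply: (obs_bra_cons _ (b := (b.1, lsubst k U b.2)) _ o').
  by rewrite (assoc_map (fun b => (b.1, lsubst k U b.2))) e.
- move=> ek oU; have [m o'] := IH ek oU; exists m.+1; apply: obs_mu.
  by rewrite -[LMu _]/(lsubst k U (LMu T)) -lsubst_lsubst.
Qed.

(** After one unfolding, a path of [LMu T] either ends inside [T] or reaches the bound variable and
    starts afresh in [LMu T] with strictly fewer unfoldings, where the induction applies. *)
Lemma obs_mu_congr T T' :
  (forall n p h, obs n T p h -> exists m, obs m T' p h) ->
  forall n p h, obs n (LMu T) p h -> exists m, obs m (LMu T') p h.
Proof.
move=> TT' n; have [N] := ubnP n; elim: N n => // N IHN n nN p h o.
case/obs_muE: o nN => n' -> /obs_lsubst[|] o nN; move: o.
  move=> [m [h0 [o0 hk ->]]]; have [m' o'] := TT' _ _ _ o0.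
  by have [m'' o''] := obs_lsubst_head (LMu T') o' hk; exists m''.+1; exact: obs_mu.
move=> [p1 [p2 [m1 [m2 [-> o1 o2 m2n]]]]].
have [m1' o1'] := TT' _ _ _ o1.
have [m2' o2'] := IHN m2 (leq_ltn_trans m2n nN) _ _ o2.
by have [m o'] := obs_lsubst_var o1' o2'; exists m.+1; exact: obs_mu.
Qed.

Lemma assoc_cat_congr (A : Type) (Q : A -> A -> Prop) l l0 (a a' : A) bs bs' b :
  (forall c, Q c c) -> Q a a' -> assoc l (bs ++ (l0, a) :: bs') = Some b ->
  exists2 b', assoc l (bs ++ (l0, a') :: bs') = Some b' & Q b b'.
Proof.
move=> Qr Qa; elim: bs => [|[l1 c] bs IH] /=.
  by case: eqP => [_ [<-]|_ e]; [exists a'|exists b].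
by case: eqP => // _ [<-]; exists c.
Qed.

(** Both inclusions are proved together because [leqv] has a symmetry rule; the only rule that is
    not local is the one under [LMu], settled by [obs_mu_congr]. *)
Lemma leqv_obs T T' : leqv T T' ->
  (forall n p h, obs n T p h -> exists m, obs m T' p h) /\
  (forall n p h, obs n T' p h -> exists m, obs m T p h).
Proof.
have sel r bs l d (S : bsort) U U' bs' :
    (forall n p h, obs n U p h -> exists m, obs m U' p h) ->
    forall n p h, obs n (LSel r (bs ++ (l, (d, S, U)) :: bs')) p h ->
    exists m, obs m (LSel r (bs ++ (l, (d, S, U')) :: bs')) p h.
  move=> UU' n p h /obs_selE[[-> ->]|[l' [b [p' [-> e o]]]]].
    exists 0%N; suff -> : unzip1 (bs ++ (l, (d, S, U)) :: bs') =
      unzip1 (bs ++ (l, (d, S, U')) :: bs') by exact: obs_sel.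
    by rewrite /unzip1 !map_cat.
  case: (assoc_cat_congr (Q := fun b b' => forall n p h,
      obs n b.2 p h -> exists m, obs m b'.2 p h) (a' := (d, S, U')) _ _ e) => //.
    by move=> c n0 p0 h' ?; exists n0.
  by move=> b' e' Q; have [m o'] := Q _ _ _ o; exists m; exact: obs_sel_cons e' o'.
have bra r bs l (S : bsort) U U' bs' :
    (forall n p h, obs n U p h -> exists m, obs m U' p h) ->
    forall n p h, obs n (LBra r (bs ++ (l, (S, U)) :: bs')) p h ->
    exists m, obs m (LBra r (bs ++ (l, (S, U')) :: bs')) p h.
  move=> UU' n p h /obs_braE[[-> ->]|[l' [b [p' [-> e o]]]]].
    exists 0%N; suff -> : unzip1 (bs ++ (l, (S, U)) :: bs') =
      unzip1 (bs ++ (l, (S, U')) :: bs') by exact: obs_bra.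
    by rewrite /unzip1 !map_cat.
  case: (assoc_cat_congr (Q := fun b b' => forall n p h,
      obs n b.2 p h -> exists m, obs m b'.2 p h) (a' := (S, U')) _ _ e) => //.
    by move=> c n0 p0 h' ?; exists n0.
  by move=> b' e' Q; have [m o'] := Q _ _ _ o; exists m; exact: obs_bra_cons e' o'.
elim=> {T T'}.
- move=> T; split=> n p h o; last by exists n.+1; exact: obs_mu.
  by case/obs_muE: o => m _ o; exists m.
- by move=> T; split=> n p h o; exists n.
- by move=> T U _ [TU UT].
- move=> T U V _ [TU UT] _ [UV VU]; split=> n p h.
    by case/TU=> m /UV.
  by case/VU=> m /UT.
- by move=> r bs l d S T T' bs' _ [TT' T'T]; split; exact: sel.
- by move=> r bs l S T T' bs' _ [TT' T'T]; split; exact: bra.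
- by move=> T T' _ [TT' T'T]; split; exact: obs_mu_congr.
Qed.

End LocalTrees.

Definition ltree := seq label -> option head.
Definition ltree_nil : ltree := fun=> None.
Definition ltree_at (l : label) (t : ltree) : ltree := fun p => t (l :: p).

Section Denotation.
Variables (R : realType) (bsort : Type).
Notation ltype := (ltype R bsort).

(** By [obs_inj] a path has at most one root, so the choice made by [cid] is immaterial. With
    functional extensionality, types related by [leqv] then have equal trees and can be
    rewritten. *)
Definition tree (T : ltype) : ltree := fun p =>
  if pselect (exists h n, obs n T p h) is left ex then Some (projT1 (cid ex))
  else None.

Lemma treeP T p h : tree T p = Some h <-> exists n, obs n T p h.
Proof.
rewrite /tree; case: pselect => [ex|nex]; last first.
  by split=> // -[n o]; case: nex; exists h, n.
case: cid => h' [m o'] /=; split=> [[<-]|[n o]]; first by exists m.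
by rewrite (obs_inj o' o).
Qed.

Lemma treeE T T' : (forall p h, (exists n, obs n T p h) <-> exists n, obs n T' p h) ->
  tree T = tree T'.
Proof.
move=> e; apply: funext => p; case e1: (tree T p) => [h|].
  by move/treeP/e/treeP: e1.
case e2: (tree T' p) => [h|] //.
by move/treeP/e/treeP: e2; rewrite e1.
Qed.

Lemma leqv_tree T T' : leqv T T' -> tree T = tree T'.
Proof.
by case/leqv_obs => TT' T'T; apply: treeE => p h; split=> -[n]; [exact: TT'|exact: T'T].
Qed.

Lemma tree_mu T : tree (LMu T) = tree (lsubst 0 (LMu T) T).
Proof. exact/leqv_tree/leqv_unfold. Qed.

Lemma tree_end : tree LEnd = ltree_nil.
Proof.
apply: funext => p; case e: tree => [h|] //.
by move/treeP: e => [n o]; inversion o.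
Qed.

Lemma tree_sel_root r bs : tree (LSel r bs) [::] = Some (HSel r (unzip1 bs)).
Proof. by apply/treeP; exists 0%N; exact: obs_sel. Qed.

Lemma tree_bra_root r bs : tree (LBra r bs) [::] = Some (HBra r (unzip1 bs)).
Proof. by apply/treeP; exists 0%N; exact: obs_bra. Qed.

Lemma tree_sel_at r bs l b : assoc l bs = Some b ->
  ltree_at l (tree (LSel r bs)) = tree b.2.
Proof.
move=> e; apply: funext => p; rewrite /ltree_at.
case e1: (tree b.2 p) => [h|].
  by move/treeP: e1 => [n o]; apply/treeP; exists n; exact: obs_sel_cons e o.
case e2: (tree _ _) => [h|] //.
move/treeP: e2 => [n /obs_selE[[//]|[l' [b' [p' [[<- <-]]]]]]].
rewrite e => -[<-] o; by rewrite (iffRL (treeP _ _ _) (ex_intro _ _ o)) in e1.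
Qed.

Lemma tree_bra_at r bs l b : assoc l bs = Some b ->
  ltree_at l (tree (LBra r bs)) = tree b.2.
Proof.
move=> e; apply: funext => p; rewrite /ltree_at.
case e1: (tree b.2 p) => [h|].
  by move/treeP: e1 => [n o]; apply/treeP; exists n; exact: obs_bra_cons e o.
case e2: (tree _ _) => [h|] //.
move/treeP: e2 => [n /obs_braE[[//]|[l' [b' [p' [[<- <-]]]]]]].
rewrite e => -[<-] o; by rewrite (iffRL (treeP _ _ _) (ex_intro _ _ o)) in e1.
Qed.

End Denotation.

(** * Global types and coinductive projection *)

(* Only communications are recorded: at [GEnd], at a free variable and at a type
   that unfolds forever, the tree has no root. *)
Definition gtree := seq label -> option (role * role * seq label).
Definition gtree_at (l : label) (g : gtree) : gtree := fun p => g (l :: p).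

Definition proj_step (X : gtree -> role -> ltree -> Prop) (g : gtree) (r : role)
    (t : ltree) : Prop :=
  if g [::] is Some (a, b, L) then
    [/\ r = a -> t [::] = Some (HSel b L) /\
          forall l, l \in L -> X (gtree_at l g) r (ltree_at l t),
        r = b -> t [::] = Some (HBra a L) /\
          forall l, l \in L -> X (gtree_at l g) r (ltree_at l t)
      & r <> a -> r <> b -> forall l, l \in L -> X (gtree_at l g) r t]
  else forall q L, t [::] <> Some (HSel q L) /\ t [::] <> Some (HBra q L).

(* Coinductive projection.  It constrains [t] only as far as [r] occurs in [g]:
   a role that is absent from an infinite branch may have any tree there, since
   the other roles keep that branch from deadlocking. *)
Definition tree_proj (g : gtree) (r : role) (t : ltree) : Prop :=
  exists2 X, (forall g r t, X g r t -> proj_step X g r t) & X g r t.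

Lemma proj_step_mono (X Y : gtree -> role -> ltree -> Prop) g r t :
  (forall g r t, X g r t -> Y g r t) -> proj_step X g r t -> proj_step Y g r t.
Proof.
move=> XY; rewrite /proj_step; case: (g [::]) => [[[a b] L]|] // [ha hb hn].
split=> [/ha[? h]|/hb[? h]|ra rb l lL]; last exact/XY/hn.
- by split=> // l lL; apply/XY/h.
- by split=> // l lL; apply/XY/h.
Qed.

Lemma tree_proj_step g r t : tree_proj g r t -> proj_step tree_proj g r t.
Proof.
move=> [X sX Xg]; apply: proj_step_mono (sX _ _ _ Xg) => g' r' t' Xg'.
by exists X.
Qed.

(** Recursion on the path instead of corecursion on the tree. The first communication from [a] to
    [b] met along the path is replaced by its branch [l]; a path that meets none is left
    unchanged. *)
Fixpoint gtree_comm (a b : role) (l : label) (g : gtree) (p : seq label) :=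
  if (if g [::] is Some (a', b', _) then (a' == a) && (b' == b) else false)
  then g (l :: p)
  else if p is l' :: p' then gtree_comm a b l (gtree_at l' g) p' else g [::].

Definition role_comm (a b : role) (l : label) (r : role) (t : ltree) : ltree :=
  if (r == a) || (r == b) then ltree_at l t else t.

Lemma gtree_comm_root a b l g L : g [::] = Some (a, b, L) ->
  gtree_comm a b l g = gtree_at l g.
Proof. by move=> e; apply: funext => -[|l' p] /=; rewrite e !eqxx. Qed.

(** Comparing senders is enough: when [a] is about to send to [b], a root with sender [a] is that
    very communication. *)
Lemma gtree_comm_nil a b l g x y L : g [::] = Some (x, y, L) -> x <> a ->
  gtree_comm a b l g [::] = Some (x, y, L).
Proof. by move=> e /eqP/negPf xa; rewrite /= e xa. Qed.

Lemma gtree_comm_at a b l g x y L l' : g [::] = Some (x, y, L) -> x <> a ->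
  gtree_at l' (gtree_comm a b l g) = gtree_comm a b l (gtree_at l' g).
Proof.
by move=> e /eqP/negPf xa; apply: funext => p; rewrite /gtree_at /= e xa.
Qed.

(** By coinduction. If the root has sender [a], the tree of [a] forces the receiver [b], and the
    result is the branch [l]. Otherwise neither [a] nor [b] takes part in the root: [a] is about to
    send, so it is not the receiver; [b] is about to receive from [a], so it is neither the sender
    nor the receiver from another role. Their trees are then projections of every branch, and the
    argument repeats below. *)
Lemma tree_proj_comm a b l g ta tb La Lb :
  tree_proj g a ta -> ta [::] = Some (HSel b La) ->
  tree_proj g b tb -> tb [::] = Some (HBra a Lb) -> l \in La ->
  forall r t, tree_proj g r t -> tree_proj (gtree_comm a b l g) r (role_comm a b l r t).
Proof.
move=> pa ea pb eb lLa r t pr.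
(* The second disjunct records that [a] and [b] are still ready, with the same sets [La] and [Lb] at
   every depth; the first takes over once the communication has been removed. *)
pose X g' r t' := tree_proj g' r t' \/ exists g ta tb t,
  [/\ [/\ g' = gtree_comm a b l g, t' = role_comm a b l r t & tree_proj g r t],
      tree_proj g a ta /\ ta [::] = Some (HSel b La) &
      tree_proj g b tb /\ tb [::] = Some (HBra a Lb)].
exists X; last by right; exists g, ta, tb, t.
move=> {g r t ta tb pa ea pb eb pr} g r t' [p|].
  by apply: proj_step_mono (tree_proj_step p); left.
move=> [h [ua [ub [u [[-> -> pr] [pa ea] [pb eb]]]]]].
have := tree_proj_step pa; have := tree_proj_step pb; have := tree_proj_step pr.
rewrite {1 2 3}/proj_step.
case e: (h [::]) => [[[x y] L]|]; last by move=> _ _ /(_ b La)[].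
case=> [rx ry rn] [bx by_ bn] [ax ay an].
have [xa|xa] := eqVneq x a.
  move: (ax (esym xa)); rewrite ea => -[[yb LL] _].
  rewrite (gtree_comm_root l (L := L)) ?e ?xa ?yb //.
  apply: (@proj_step_mono tree_proj); first by move=> *; left.
  apply: tree_proj_step; rewrite /role_comm; subst x y La.
  have [ra|/eqP ra] /= := eqVneq r a; first by case: (rx ra) => _; apply.
  have [rb|/eqP rb] /= := eqVneq r b; first by case: (ry rb) => _; apply.
  exact: rn.
have {}xa : x <> a by apply/eqP.
have ya : y <> a by move=> ya; case: (ay (esym ya)); rewrite ea.
have bx' : b <> x by move=> bx'; case: (bx bx'); rewrite eb.
have by' : b <> y by move=> by'; case: (by_ by'); rewrite eb => -[/esym].
rewrite /proj_step (gtree_comm_nil b l e xa).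
have Xn l' v : l' \in L -> tree_proj (gtree_at l' h) r v ->
    X (gtree_at l' (gtree_comm a b l h)) r (role_comm a b l r v).
  move=> lL pv; right; exists (gtree_at l' h), ua, ub, v.
  rewrite (gtree_comm_at b l l' e xa); split=> //; split=> //.
    exact: an (nesym xa) (nesym ya) l' lL.
  exact: bn.
split=> [erx|ery|nrx nry l' lL].
- have [ru pu] := rx erx; have -> : role_comm a b l r u = u.
    by rewrite /role_comm erx (introF eqP xa) (introF eqP (nesym bx')).
  split=> // l' lL; have := Xn l' _ lL (pu l' lL).
  by rewrite /role_comm erx (introF eqP xa) (introF eqP (nesym bx')).
- have [ru pu] := ry ery; have -> : role_comm a b l r u = u.
    by rewrite /role_comm ery (introF eqP ya) (introF eqP (nesym by')).
  split=> // l' lL; have := Xn l' _ lL (pu l' lL).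
  by rewrite /role_comm ery (introF eqP ya) (introF eqP (nesym by')).
- exact/Xn/rn.
Qed.

Definition coherent (C : role -> ltree) : Prop :=
  exists g, forall r, tree_proj g r (C r).

Lemma coherent_nil : coherent (fun=> ltree_nil).
Proof.
exists (fun=> None) => r; exists (fun g r t => g = (fun=> None) /\ t = ltree_nil) => //.
by move=> g r' t [-> ->].
Qed.

Lemma coherent_comm C a b La Lb l : coherent C ->
  C a [::] = Some (HSel b La) -> C b [::] = Some (HBra a Lb) -> l \in La ->
  coherent (fun r => role_comm a b l r (C r)).
Proof.
move=> [g pg] ea eb lL; exists (gtree_comm a b l g) => r.
exact: tree_proj_comm (pg a) ea (pg b) eb lL _ _ (pg r).
Qed.

(** The role [r] need not take part in the communication found: its action only shows that the
    global tree has a root, and the root dictates the trees of its own sender and receiver, with a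
    common label set. A variable head is compatible with a rootless global tree, hence its
    exclusion. *)
Lemma coherent_progress C r h : coherent C -> C r [::] = Some h ->
  (forall t, h <> HVar t) ->
  exists a b L, C a [::] = Some (HSel b L) /\ C b [::] = Some (HBra a L).
Proof.
move=> [g pg] er nv; case e: (g [::]) => [[[a b] L]|].
  exists a, b, L; move: (tree_proj_step (pg a)) (tree_proj_step (pg b)).
  by rewrite /proj_step e => -[/(_ erefl)[-> _] _ _] [_ /(_ erefl)[-> _] _].
move: (tree_proj_step (pg r)); rewrite /proj_step e er.
by case: h nv {er} => [q L _ /(_ q L)[]|q L _ /(_ q L)[]|t /(_ t)].
Qed.

(** * Coherence of the projections of a global type *)

Section GlobalTrees.
Variables (R : realType) (bsort : Type).
Notation ltype := (ltype R bsort).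
Notation gtype := (gtype R bsort).

Fixpoint gshift (k : nat) (G : gtype) : gtype :=
  match G with
  | GComm a b bs => GComm a b [seq (x.1, (x.2.1, gshift k x.2.2)) | x <- bs]
  | GMu G => GMu (gshift k.+1 G)
  | GVar t => GVar (if (t < k)%N then t else t.+1)
  | GEnd => GEnd
  end.

Fixpoint gsubst (k : nat) (U G : gtype) : gtype :=
  match G with
  | GComm a b bs => GComm a b [seq (x.1, (x.2.1, gsubst k U x.2.2)) | x <- bs]
  | GMu G => GMu (gsubst k.+1 (gshift 0 U) G)
  | GVar t => if (t < k)%N then GVar t else if t == k then U else GVar t.-1
  | GEnd => GEnd
  end.

Lemma gtype_ind_In (P : gtype -> Prop) :
  (forall a b bs, (forall x, List.In x bs -> P x.2.2) -> P (GComm a b bs)) ->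
  (forall G, P G -> P (GMu G)) ->
  (forall t, P (GVar t)) ->
  P GEnd -> forall G, P G.
Proof.
move=> hc hm hv he; fix IH 1 => -[a b bs|G|t|].
- apply: hc; elim: bs => [|[l [d G]] bs IHbs] x; first by case.
  by case=> [<- /=|/IHbs]; [exact: IH G | apply].
- exact/hm/IH.
- exact: hv.
- exact: he.
Qed.

Lemma In_map_item (A B C : Type) (f : B -> C) l a c (s : seq (label * (A * B))) :
  List.In (l, (a, c)) [seq (x.1, (x.2.1, f x.2.2)) | x <- s] ->
  exists2 b, List.In (l, (a, b)) s & c = f b.
Proof.
elim: s => //= -[l' [a' b]] s IH [[<- <- <-]|/IH[b' ? ?]]; first by exists b; [left|].
by exists b'; [right|].
Qed.

Lemma proj_shift k G r T : proj G r T -> proj (gshift k G) r (lshift k T).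
Proof.
move=> pG; elim: pG k => {G r T} /=.
- move=> r r2 bs ts rr2 e _ IH k; apply: proj_send => //.
    by rewrite -!map_comp /=; exact: e.
  move=> l d S G T  /(@In_map_item _ _ _ _ _ _ _ _)[G' inG ->].
  move=> /(@In_map_item _ _ _ _ _ _ _ _)[T' inT ->].
  exact: IH inG inT k.
- move=> r1 r bs ts rr2 e _ IH k; apply: proj_recv => //.
    by rewrite -!map_comp /=; exact: e.
  move=> l d S G T /(@In_map_item _ _ _ _ _ _ _ _)[G' inG ->].
  move=> /(@In_map_item _ _ _ _ _ _ _ _)[T' inT ->].
  exact: IH inG inT k.
- move=> r1 r2 r bs T rr1 rr2 nbs _ IH k; apply: proj_other => //.
    by case: bs nbs {IH}.
  move=> l d S G /(@In_map_item _ _ _ _ _ _ _ _)[G' inG ->].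
  exact: IH inG k.
- move=> G r T _ IH nT k; apply: proj_mu; first exact: IH.
  by case: T nT {IH}.
- by move=> G r _ IH k; exact: proj_mu_end.
- by move=> t r k; exact: proj_var.
- by move=> r k; exact: proj_end.
Qed.

(** A variable projects onto a variable, so a global type that projects onto [LEnd] contains no
    variable to substitute for. *)
Lemma proj_subst_end k U G r : proj G r LEnd -> proj (gsubst k U G) r LEnd.
Proof.
move eT: LEnd => T pG; elim: pG eT k U => {G r T} //=.
- move=> r1 r2 r bs T rr1 rr2 nbs _ IH eT k U; apply: proj_other => //.
    by case: bs nbs {IH}.
  move=> l d S G /(@In_map_item _ _ _ _ _ _ _ _)[G' inG ->].
  exact: IH inG eT k U.
- by move=> G r _ IH eT k U; apply: proj_mu_end; exact: IH.
- by move=> *; exact: proj_end.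
Qed.

(** The condition [V <> LEnd] keeps the two projection rules for [GMu] apart: putting [LEnd] for a
    variable could turn the body of an [LMu] into [LEnd], and the projection would then be
    [LEnd]. *)
Lemma proj_subst k U V G r T : proj U r V -> V <> LEnd ->
  proj G r T -> proj (gsubst k U G) r (lsubst k V T).
Proof.
move=> pU nV pG; elim: pG k U V pU nV => {G r T} /=.
- move=> r r2 bs ts rr2 e _ IH k U V pU nV; apply: proj_send => //.
    by rewrite -!map_comp /=; exact: e.
  move=> l d S G T /(@In_map_item _ _ _ _ _ _ _ _)[G' inG ->].
  move=> /(@In_map_item _ _ _ _ _ _ _ _)[T' inT ->].
  exact: IH inG inT k U V pU nV.
- move=> r1 r bs ts rr2 e _ IH k U V pU nV; apply: proj_recv => //.
    by rewrite -!map_comp /=; exact: e.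
  move=> l d S G T /(@In_map_item _ _ _ _ _ _ _ _)[G' inG ->].
  move=> /(@In_map_item _ _ _ _ _ _ _ _)[T' inT ->].
  exact: IH inG inT k U V pU nV.
- move=> r1 r2 r bs T rr1 rr2 nbs _ IH k U V pU nV; apply: proj_other => //.
    by case: bs nbs {IH}.
  move=> l d S G /(@In_map_item _ _ _ _ _ _ _ _)[G' inG ->].
  exact: IH inG k U V pU nV.
- move=> G r T _ IH nT k U V pU nV.
  have nV' : lshift 0 V <> LEnd by case: V nV {pU}.
  apply: proj_mu; first by apply: IH nV'; exact: proj_shift.
  case: T nT {IH} => //= t _; case: ifP => // _; case: ifP => // _; exact: nV'.
- by move=> G r pG _ k U V _ _; exact/proj_mu_end/proj_subst_end.
- move=> t r k U V pU nV; case: ifP => // _; first exact: proj_var.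
  by case: ifP => // _; exact: proj_var.
- by move=> *; exact: proj_end.
Qed.

Lemma proj_commE a b (bs : seq (label * (iprob R * bsort * gtype))) r T :
  proj (GComm a b bs) r T ->
  [\/ exists ts, [/\ r = a, r != b, T = LSel b ts,
        [seq (x.1, x.2.1) | x <- bs] = [seq (t.1, t.2.1) | t <- ts] &
        forall l d S G U, List.In (l, (d, S, G)) bs ->
          List.In (l, (d, S, U)) ts -> proj G r U],
      exists ts, [/\ r != a, r = b, T = LBra a ts,
        [seq (x.1, x.2.1.2) | x <- bs] = [seq (t.1, t.2.1) | t <- ts] &
        forall l d S G U, List.In (l, (d, S, G)) bs ->
          List.In (l, (S, U)) ts -> proj G r U] |
      [/\ r != a, r != b &
        forall l d S G, List.In (l, (d, S, G)) bs -> proj G r T]].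
Proof.
move=> pG; inversion pG; subst.
- by constructor 1; exists ts.
- by constructor 2; exists ts.
- by constructor 3.
Qed.

Lemma proj_unfold G r T : proj (GMu G) r T ->
  exists2 T', proj (gsubst 0 (GMu G) G) r T' & tree T = tree T'.
Proof.
move=> pG; inversion pG; subst.
  exists (lsubst 0 (LMu T0) T0); last exact: tree_mu.
  by apply: proj_subst => //; apply: proj_mu.
by exists LEnd => //; exact: proj_subst_end.
Qed.

Lemma roles_shift k G : roles (gshift k G) = roles G.
Proof.
elim/gtype_ind_In: G k => //= a b bs IH k.
congr (_ :: _ :: flatten _); rewrite -map_comp.
by apply: map_ext_In => x inx /=; exact: IH.
Qed.

Lemma roles_subst k U G r : r \in roles (gsubst k U G) ->
  (r \in roles G) || (r \in roles U).
Proof.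
elim/gtype_ind_In: G k U => //= [a b bs IH|G IH|t] k U.
- rewrite !inE -!orbA; case: (r == a) => //=; case: (r == b) => //=.
  rewrite -map_comp; elim: bs IH => //= x bs IHbs IH.
  rewrite !mem_cat -orbA => /orP[/(IH x (or_introl erefl))/orP[->//|->]|].
    by rewrite !orbT.
  by move/IHbs => ->; [rewrite orbT | move=> y yb; apply: IH; right].
- by move/IH; rewrite roles_shift.
- by case: ifP => // _; case: ifP.
Qed.

Inductive gobs : gtype -> seq label -> role * role * seq label -> Prop :=
| gobs_comm a b bs : gobs (GComm a b bs) [::] (a, b, unzip1 bs)
| gobs_cons a b bs l x p h :
    assoc l bs = Some x -> gobs x.2 p h -> gobs (GComm a b bs) (l :: p) h
| gobs_mu G p h : gobs (gsubst 0 (GMu G) G) p h -> gobs (GMu G) p h.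

Lemma gobs_commE a b bs p h : gobs (GComm a b bs) p h ->
  p = [::] /\ h = (a, b, unzip1 bs) \/
  exists l x p', [/\ p = l :: p', assoc l bs = Some x & gobs x.2 p' h].
Proof. by move=> o; inversion o; subst; [left|right; exists l, x, p0]. Qed.

Lemma gobs_muE G p h : gobs (GMu G) p h -> gobs (gsubst 0 (GMu G) G) p h.
Proof. by move=> o; inversion o. Qed.

Lemma gobs_inj G p h h' : gobs G p h -> gobs G p h' -> h = h'.
Proof.
move=> o; elim: o h' => {G p h} [a b bs|a b bs l x p h e _ IH|G p h _ IH] h'.
- by case/gobs_commE => [[_ ->]|[? [? [? []]]]].
- by case/gobs_commE => [[]//|[l' [x' [p' [[<- <-]]]]]]; rewrite e => -[<-] /IH.
- by move/gobs_muE/IH.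
Qed.

Definition gtree_of (G : gtype) : gtree := fun p =>
  if pselect (exists h, gobs G p h) is left ex then Some (projT1 (cid ex)) else None.

Lemma gtree_ofP G p h : gtree_of G p = Some h <-> gobs G p h.
Proof.
rewrite /gtree_of; case: pselect => [ex|nex]; last first.
  by split=> // o; case: nex; exists h.
case: cid => h' o' /=; split=> [[<-] //|o].
by rewrite (gobs_inj o' o).
Qed.

Lemma gtree_of_mu G : gtree_of (GMu G) = gtree_of (gsubst 0 (GMu G) G).
Proof.
apply: funext => p; case e: (gtree_of (gsubst _ _ _) p) => [h|].
  by apply/gtree_ofP/gobs_mu/gtree_ofP.
by case e': (gtree_of _ _) => [h|] //; move/gtree_ofP/gobs_muE/gtree_ofP: e'; rewrite e.
Qed.

Lemma gtree_of_at a b bs l x : assoc l bs = Some x ->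
  gtree_at l (gtree_of (GComm a b bs)) = gtree_of x.2.
Proof.
move=> e; apply: funext => p; rewrite /gtree_at.
case e1: (gtree_of x.2 p) => [h|].
  by move/gtree_ofP: e1 => o; apply/gtree_ofP; exact: gobs_cons e o.
case e2: (gtree_of _ _) => [h|] //.
move/gtree_ofP: e2 => /gobs_commE[[//]|[l' [x' [p' [[<- <-]]]]]].
by rewrite e => -[<-] /gtree_ofP; rewrite e1.
Qed.

(** A root is reached after finitely many unfoldings, which change neither the global tree nor the
    trees of the projections. In the presence of a root, [G] may thus be taken to start with a
    communication. *)
Lemma gobs_root G a b L : gobs G [::] (a, b, L) ->
  exists bs, [/\ L = unzip1 bs, gtree_of G = gtree_of (GComm a b bs),
    forall r T, proj G r T ->
      exists2 T', proj (GComm a b bs) r T' & tree T = tree T' &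
    forall r, r \notin roles G -> r \notin roles (GComm a b bs)].
Proof.
move ep: [::] => p; move eh: (a, b, L) => h o.
elim: o ep eh => {G p h} [a' b' bs|//|G p h o IH] ep eh.
  by case: eh => <- <- ->; exists bs; split=> // r T pT; exists T.
have [bs [eL eg ps rs]] := IH ep eh; exists bs; split=> //.
- by rewrite gtree_of_mu.
- by move=> r T /proj_unfold[T' /ps[T'' pT'' ->] ->]; exists T''.
- by move=> r rG; apply: rs; apply: contra rG => /roles_subst; rewrite orbb.
Qed.

(** Unfoldings of the local type go in step with those of the global one: a [GMu] from which the
    role is absent projects onto [LEnd], which has no root to observe. *)
Lemma obs_gobs n T h G r : obs n T [::] h -> (forall t, h <> HVar t) ->
  proj G r T -> exists x, gobs G [::] x.
Proof.
move ep: [::] => p o; elim: o ep G => {n T p h} //.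
- move=> q bs _ G _ pG; inversion pG; subst; first by eexists; exact: gobs_comm.
  by eexists; exact: gobs_comm.
- move=> q bs _ G _ pG; inversion pG; subst; first by eexists; exact: gobs_comm.
  by eexists; exact: gobs_comm.
- by move=> t _ G /(_ t).
- move=> n T p h o IH ep G nv pG; inversion pG; subst.
    by eexists; exact: gobs_comm.
  have [x gx] : exists x, gobs (gsubst 0 (GMu G0) G0) [::] x.
    by apply: IH => //; apply: proj_subst => //; exact: proj_mu.
  by exists x; exact: gobs_mu.
Qed.

Lemma coherent_proj (G : gtype) C :
  (forall r, r \in roles G -> exists2 T, proj G r T & C r = tree T) ->
  (forall r, r \notin roles G -> C r = ltree_nil) -> coherent C.
Proof.
move=> Cin Cout; exists (gtree_of G) => r0.
(* A role outside [G] gets [ltree_nil] and not a projection, because [G] need not be projectable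
   onto it. *)
pose X g r t := exists2 G, g = gtree_of G &
  (exists2 T, proj G r T & t = tree T) \/ (r \notin roles G /\ t = ltree_nil).
exists X; last first.
  exists G => //; case: (boolP (r0 \in roles G)) => r0G; first by left; exact: Cin.
  by right; split=> //; exact: Cout.
move=> g r t [{}G {Cin Cout} -> pt]; rewrite /proj_step.
case e: (gtree_of G [::]) => [[[a b] L]|]; last first.
  case: pt => [[T pT ->]|[_ ->]] q L //.
  split=> /treeP[n o]; have [|x /gtree_ofP] := obs_gobs o _ pT => //; by rewrite e.
move/gtree_ofP/gobs_root: e => [bs [-> -> pbs rbs]].
have inbs l : l \in unzip1 bs -> exists x, assoc l bs = Some x by exact: assoc_unzip1.
case: pt => [[T /pbs[T' pT' ->] ->]|[/rbs rG ->]]; last first.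
  split; [by move=> ra; move: rG; rewrite ra !inE eqxx|
          by move=> rb; move: rG; rewrite rb !inE eqxx orbT|].
  move=> _ _ l /inbs[[[d S] G'] e]; rewrite (gtree_of_at _ _ e); exists G' => //.
  right; split=> //; apply: contra rG => rG'; rewrite !inE; apply/orP; right; apply/orP; right.
  apply/flattenP; exists (roles G') => //; move: (assoc_In e) => {e inbs pbs rbs rG'}.
  elim: bs => //= x bs IH [->|/IH]; rewrite inE ?eqxx //.
  by move=> ->; rewrite orbT.
case: (proj_commE pT') => [[ts [ra rb -> e pts]]|[ts [ra rb -> e pts]]|[ra rb pT'']].
- split=> [_|/eqP|/(_ ra)//]; last by rewrite (negPf rb).
  split; first by rewrite tree_sel_root (unzip1_eq_map (f := fst) (g := fst) e).
  move=> l /inbs[[[d S] G'] el]; rewrite (gtree_of_at _ _ el).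
  have [[[d' S'] U] e' [? ?]] := assoc_eq_map (f := fst) (g := fst) e el; subst.
  rewrite (tree_sel_at _ e'); exists G' => //; left; exists U => //.
  exact: pts (assoc_In el) (assoc_In e').
- split=> [/eqP|_|_ /(_ rb)//]; first by rewrite (negPf ra).
  split; first by rewrite tree_bra_root (unzip1_eq_map (f := fun x => x.1.2) (g := fst) e).
  move=> l /inbs[[[d S] G'] el]; rewrite (gtree_of_at _ _ el).
  have [[S' U] e' /= ?] := assoc_eq_map (f := fun x => x.1.2) (g := fst) e el; subst.
  rewrite (tree_bra_at _ e'); exists G' => //; left; exists U => //.
  exact: pts (assoc_In el) (assoc_In e').
- split; [by move/eqP; rewrite (negPf ra)|by move/eqP; rewrite (negPf rb)|].
  move=> _ _ l /inbs[[[d S] G'] el]; rewrite (gtree_of_at _ _ el); exists G' => //.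
  by left; exists T' => //; exact: pT'' (assoc_In el).
Qed.

End GlobalTrees.

(** * A typing invariant *)

Lemma map_eq0 (A B : Type) (f : A -> B) s : map f s = [::] -> s = [::].
Proof. by case: s. Qed.

(* Total environments: an unused channel has the tree [ltree_nil]. *)
Definition env := chan -> ltree.
Definition env_nil : env := fun=> ltree_nil.
Definition env_one (c : chan) (t : ltree) : env :=
  fun c' => if pselect (c' = c) then t else ltree_nil.
Definition env_res (C : role -> ltree) (D : env) : env := fun c =>
  match c with
  | CVar i => D (CVar i)
  | CSess 0 r => C r
  | CSess s.+1 r => D (CSess s r)
  end.
Definition env_split (D D1 D2 : env) : Prop := forall c,
  D1 c = D c /\ D2 c = ltree_nil \/ D1 c = ltree_nil /\ D2 c = D c.

Lemma env_one_eq c t : env_one c t c = t.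
Proof. by rewrite /env_one; case: pselect. Qed.

Lemma env_one_neq c c' t : c' <> c -> env_one c t c' = ltree_nil.
Proof. by rewrite /env_one; case: pselect. Qed.

Lemma env_one_nil c : env_one c ltree_nil = env_nil.
Proof. by apply: funext => c'; rewrite /env_one; case: pselect. Qed.

Lemma env_one_supp c t c' : env_one c t c' <> ltree_nil -> c' = c.
Proof. by rewrite /env_one; case: pselect. Qed.

Lemma env_split_sym D D1 D2 : env_split D D1 D2 -> env_split D D2 D1.
Proof. by move=> s c; case: (s c) => -[]; [right|left]. Qed.

Lemma env_split_nilr D : env_split D D env_nil.
Proof. by left. Qed.

Lemma env_split_nil D D1 : env_split D D1 env_nil -> D1 = D.
Proof. by move=> s; apply: funext => c; case: (s c) => -[-> //]. Qed.

Lemma env_splitA D D12 D1 D2 D3 : env_split D D12 D3 -> env_split D12 D1 D2 ->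
  exists2 D23, env_split D D1 D23 & env_split D23 D2 D3.
Proof.
(* The middle environment takes every channel that [D1] does not use. *)
move=> s s'; exists (fun c => if pselect (D1 c = ltree_nil) then D c else ltree_nil).
  move=> c; case: pselect => [D1c|D1c] /=; first by right.
  left; split=> //; case: (s' c) => -[e1 _] //.
  by case: (s c) => -[e2 _]; [rewrite e1|case: D1c; rewrite e1].
move=> c; case: pselect => [h|h] /=; case: (s' c) => -[e3 e4] //; case: (s c) => -[e1 e2].
- by left; rewrite e4 e2 -e1 -e3 h.
- by right; rewrite e4.
- by left; rewrite e4.
- by right; rewrite e4.
- by left; rewrite e4.
- by case: h; rewrite e3.
Qed.

(** The arities of a declaration, the position of the one channel formal that its body may use, and
    the tree of that formal. *)
Record decl_type := DeclType {
  decl_exprs : nat; decl_chans : nat; decl_pos : nat; decl_tree : ltree }.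

(** In the second alternative no formal is in use, as when [n = 0]. The position is then
    meaningless, and so is the default of [nth] in [wt_call], since [env_one c ltree_nil] is empty
    for every [c]. *)
Definition decl_ok (m n : nat) (e : decl_type) : Prop :=
  [/\ decl_exprs e = m, decl_chans e = n
    & (decl_pos e < n)%N \/ decl_tree e = ltree_nil].

Definition decls := nat -> option decl_type.
Definition decls_cons (e : option decl_type) (Gp : decls) : decls :=
  fun i => if i is j.+1 then Gp j else e.

Section Typing.
Variables (R : realType) (bsort bval : Type).
Notation proc := (proc R bsort bval).

Lemma proc_ind_In (K : proc -> Prop) :
  (forall c r bs, (forall b, List.In b bs -> K b.2.2) -> K (PSel c r bs)) ->
  (forall c r bs, (forall b, List.In b bs -> K b.2) -> K (PBra c r bs)) ->
  (forall oG P, K P -> K (PRes oG P)) ->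
  (forall m n B Q, K B -> K Q -> K (PDef m n B Q)) ->
  (forall X vs cs, K (PCall X vs cs)) ->
  K PNil ->
  (forall P Q, K P -> K Q -> K (PPar P Q)) -> forall P, K P.
Proof.
move=> hs hb hr hd hc hn hp; fix IH 1 => -[c r bs|c r bs|oG P|m n B Q|X vs cs||P Q].
- apply: hs; elim: bs => [|[l [d P]] bs IHbs] b; first by case.
  by case=> [<- /=|/IHbs]; [exact: IH P | apply].
- apply: hb; elim: bs => [|[l P] bs IHbs] b; first by case.
  by case=> [<- /=|/IHbs]; [exact: IH P | apply].
- exact/hr/IH.
- by apply: hd; exact: IH.
- exact: hc.
- exact: hn.
- by apply: hp; exact: IH.
Qed.

(* Every prefix owns exactly one channel.  Annotations are ignored, since a
   communication changes the type of a session but not its annotation: a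
   restriction only has to be typable by some coherent family of trees.
   A declaration typed by [None] is never called and its body is not checked. *)
Inductive wt : decls -> proc -> env -> Prop :=
| wt_sel Gp c r (bs : seq (label * (R * expr bval * proc))) t :
    bs <> [::] -> t [::] = Some (HSel r (unzip1 bs)) ->
    (forall l x P, List.In (l, (x, P)) bs -> wt Gp P (env_one c (ltree_at l t))) ->
    wt Gp (PSel c r bs) (env_one c t)
| wt_bra Gp c r (bs : seq (label * proc)) t :
    bs <> [::] -> t [::] = Some (HBra r (unzip1 bs)) ->
    (forall l P, List.In (l, P) bs -> wt Gp P (env_one c (ltree_at l t))) ->
    wt Gp (PBra c r bs) (env_one c t)
| wt_res Gp oG P C D : coherent C -> wt Gp P (env_res C D) -> wt Gp (PRes oG P) D
| wt_def Gp m n B Q oe D :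
    (forall e, oe = Some e -> decl_ok m n e) ->
    (forall e, oe = Some e ->
       wt (decls_cons oe Gp) B (env_one (CVar (decl_pos e)) (decl_tree e))) ->
    wt (decls_cons oe Gp) Q D -> wt Gp (PDef m n B Q) D
| wt_call Gp X vs cs e :
    Gp X = Some e -> decl_ok (size vs) (size cs) e ->
    wt Gp (PCall X vs cs) (env_one (nth (CVar 0) cs (decl_pos e)) (decl_tree e))
| wt_nil Gp : wt Gp PNil env_nil
| wt_par Gp P Q D D1 D2 :
    env_split D D1 D2 -> wt Gp P D1 -> wt Gp Q D2 -> wt Gp (PPar P Q) D.

Lemma wt_selE Gp c r bs D : wt Gp (PSel c r bs) D -> exists t,
  [/\ D = env_one c t, bs <> [::], t [::] = Some (HSel r (unzip1 bs)) &
   forall l x P, List.In (l, (x, P)) bs -> wt Gp P (env_one c (ltree_at l t))].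
Proof. by move=> w; inversion w; subst; exists t. Qed.

Lemma wt_braE Gp c r bs D : wt Gp (PBra c r bs) D -> exists t,
  [/\ D = env_one c t, bs <> [::], t [::] = Some (HBra r (unzip1 bs)) &
   forall l P, List.In (l, P) bs -> wt Gp P (env_one c (ltree_at l t))].
Proof. by move=> w; inversion w; subst; exists t. Qed.

Lemma wt_resE Gp oG P D : wt Gp (PRes oG P) D ->
  exists2 C, coherent C & wt Gp P (env_res C D).
Proof. by move=> w; inversion w; subst; exists C. Qed.

Lemma wt_defE Gp m n B Q D : wt Gp (PDef m n B Q) D -> exists oe,
  [/\ forall e, oe = Some e -> decl_ok m n e, forall e, oe = Some e ->
       wt (decls_cons oe Gp) B (env_one (CVar (decl_pos e)) (decl_tree e)) &
      wt (decls_cons oe Gp) Q D].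
Proof. by move=> w; inversion w; subst; exists oe. Qed.

Lemma wt_callE Gp X vs cs D : wt Gp (PCall X vs cs) D -> exists e,
  [/\ Gp X = Some e, decl_ok (size vs) (size cs) e &
   D = env_one (nth (CVar 0) cs (decl_pos e)) (decl_tree e)].
Proof. by move=> w; inversion w; subst; exists e. Qed.

Lemma wt_nilE Gp D : wt Gp PNil D -> D = env_nil.
Proof. by move=> w; inversion w. Qed.

Lemma wt_parE Gp P Q D : wt Gp (PPar P Q) D -> exists D1 D2,
  [/\ env_split D D1 D2, wt Gp P D1 & wt Gp Q D2].
Proof. by move=> w; inversion w; subst; exists D1, D2. Qed.

(** * Substitutions and renamings *)

Definition shift_chan : chan -> chan := subst_chan S CVar.

Lemma shift_chanP c : (exists r, c = CSess 0 r) \/ exists c', c = shift_chan c'.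
Proof.
case: c => [i|[|s] r]; [right; by exists (CVar i)|left; by exists r|].
by right; exists (CSess s r).
Qed.

Lemma env_res_shift C D c : env_res C D (shift_chan c) = D c.
Proof. by case: c. Qed.

Lemma shift_chan_inj : injective shift_chan.
Proof. by case=> [i|s r] [j|s' r'] //= [] -> // ->. Qed.

(* A substitution of channels need not be injective, as long as it does not
   identify two channels in use. *)
Definition env_push (f : chan -> chan) (D D' : env) : Prop :=
  [/\ forall c, D c <> ltree_nil -> D' (f c) = D c,
      forall c', D' c' <> ltree_nil -> exists2 c, f c = c' & D c <> ltree_nil &
      forall c1 c2, D c1 <> ltree_nil -> D c2 <> ltree_nil -> f c1 = f c2 -> c1 = c2].

Lemma env_push_one f c t : env_push f (env_one c t) (env_one (f c) t).
Proof.
split.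
- by move=> c' /env_one_supp ->; rewrite !env_one_eq.
- move=> c' nc; have ec := env_one_supp nc; exists c; first by rewrite ec.
  by rewrite env_one_eq => et; apply: nc; rewrite ec env_one_eq.
- by move=> c1 c2 /env_one_supp -> /env_one_supp ->.
Qed.

Lemma env_push_uniq f D D1 D2 : env_push f D D1 -> env_push f D D2 -> D1 = D2.
Proof.
move=> [a1 b1 _] [a2 b2 _]; apply: funext => c.
case: (pselect (D1 c = ltree_nil)) => [e1|/b1[c' <- nc']]; last first.
  by rewrite a1 ?a2.
case: (pselect (D2 c = ltree_nil)) => [->//|/b2[c' e' nc']].
by move: (a1 _ nc'); rewrite e' e1 => /esym.
Qed.

Lemma env_push_nil f : env_push f env_nil env_nil.
Proof. by split. Qed.

Lemma env_push_nilE f D : env_push f env_nil D -> D = env_nil.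
Proof.
move=> [_ h _]; apply: funext => c.
by case: (pselect (D c = ltree_nil)) => // /h[].
Qed.

Lemma env_push_res rs (sc : nat -> chan) C D D' : env_push (subst_chan rs sc) D D' ->
  env_push (subst_chan (lift_ren 1 rs) (shift_chan \o sc)) (env_res C D) (env_res C D').
Proof.
set f := subst_chan rs sc; set g := subst_chan _ _.
have g0 r : g (CSess 0 r) = CSess 0 r by [].
have gS c : g (shift_chan c) = shift_chan (f c).
  by case: c => [i|s r] //=; rewrite /lift_ren /= subn1.
have nS c r : shift_chan c <> CSess 0 r by case: c.
move=> [a b i]; split.
- move=> c; case: (shift_chanP c) => [[r ->]|[c' ->]]; first by rewrite g0.
  by rewrite gS !env_res_shift; exact: a.
- move=> c; case: (shift_chanP c) => [[r ->]|[c' ->]]; first by exists (CSess 0 r).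
  by rewrite env_res_shift => /b[c0 <- nc0]; exists (shift_chan c0); rewrite ?env_res_shift.
- move=> c1 c2; case: (shift_chanP c1) => [[r1 ->]|[d1 ->]];
    case: (shift_chanP c2) => [[r2 ->]|[d2 ->]]; rewrite ?g0 ?gS //.
  + by move=> _ _ /esym/nS.
  + by move=> _ _ /nS.
  + by rewrite !env_res_shift => n1 n2 /shift_chan_inj /(i _ _ n1 n2) ->.
Qed.

(** A channel goes to the first part when it is the image of a channel used by [D1]. Injectivity on
    the channels in use keeps the images of those of [D2] out of it. *)
Lemma env_push_split f D D1 D2 D' : env_split D D1 D2 -> env_push f D D' ->
  exists D1' D2', [/\ env_split D' D1' D2', env_push f D1 D1' & env_push f D2 D2'].
Proof.
move=> s [a b i].
pose in1 c' := exists2 c, f c = c' & D1 c <> ltree_nil.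
have sub1 c : D1 c <> ltree_nil -> D1 c = D c by case: (s c) => -[-> //].
have sub2 c : D2 c <> ltree_nil -> D2 c = D c by case: (s c) => -[_ -> //].
exists (fun c' => if pselect (in1 c') then D' c' else ltree_nil).
exists (fun c' => if pselect (in1 c') then ltree_nil else D' c'); split.
- by move=> c; case: pselect; [left|right].
- split.
  + move=> c nc; case: pselect => /= [_|[]]; last by exists c.
    by rewrite a -?sub1 // sub1.
  + by move=> c; case: pselect.
  + by move=> c1 c2 n1 n2; apply: i; rewrite -sub1.
- split.
  + move=> c nc; have n2 := nc; rewrite sub2 // in n2.
    case: pselect => /= [[c1 e n1]|_]; last by rewrite a // -sub2.
    have n1' := n1; rewrite sub1 // in n1'.
    by move: nc n1; rewrite (i _ _ n1' n2 e); case: (s c) => -[-> ->].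
  + move=> c'; case: pselect => //= n1 /b[c e nc]; exists c => //.
    case: (s c) => -[e1 e2]; last by rewrite e2.
    by case: n1; exists c => //; rewrite e1.
  + by move=> c1 c2 n1 n2; apply: i; rewrite -sub2.
Qed.

Lemma decls_cons_lift oe (Gp Gp' : decls) rX : (forall X, Gp' (rX X) = Gp X) ->
  forall X, decls_cons oe Gp' (lift_ren 1 rX X) = decls_cons oe Gp X.
Proof. by move=> e [|X] //=; rewrite /lift_ren /= subn1 e. Qed.

(** One statement covers renamings, the value received in a communication and the arguments of a
    call. The substitution [se] is arbitrary because [wt] does not look at expressions. *)
Lemma wt_subst Gp P D : wt Gp P D -> forall Gp' rs se sc rX D',
  (forall X, Gp' (rX X) = Gp X) -> env_push (subst_chan rs sc) D D' ->
  wt Gp' (subst rs se sc rX P) D'.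
Proof.
elim=> {Gp P D}.
- move=> Gp c r bs t nbs et _ IH Gp' rs se sc rX D' eX pD.
  rewrite -(env_push_uniq (env_push_one _ _ _) pD) /=; apply: wt_sel.
  + by move/map_eq0.
  + by rewrite et /unzip1 -map_comp.
  + move=> l x P; elim: bs IH {nbs et} => //= -[l' [x' P']] bs IHbs IH.
    case=> [[<- _ <-]|]; first by apply: (IH l' x' P') => //; [left|exact: env_push_one].
    by apply: IHbs => l0 x0 P0 H; exact: IH l0 x0 P0 (or_intror H).
- move=> Gp c r bs t nbs et _ IH Gp' rs se sc rX D' eX pD.
  rewrite -(env_push_uniq (env_push_one _ _ _) pD) /=; apply: wt_bra.
  + by move/map_eq0.
  + by rewrite et /unzip1 -map_comp.
  + move=> l P; elim: bs IH {nbs et} => //= -[l' P'] bs IHbs IH.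
    case=> [[<- <-]|]; first by apply: (IH l' P') => //; [left|exact: env_push_one].
    by apply: IHbs => l0 P0 H; exact: IH l0 P0 (or_intror H).
- move=> Gp oG P C D cC _ IH Gp' rs se sc rX D' eX pD /=.
  by apply: (wt_res _ cC); apply: IH => //; exact: env_push_res.
- move=> Gp m n B Q oe D ok _ IHB _ IHQ Gp' rs se sc rX D' eX pD /=.
  apply: (wt_def (oe := oe)) => //; last by apply: IHQ pD; exact: decls_cons_lift.
  move=> e ee; apply: (IHB e ee); first exact: decls_cons_lift.
  have [_ _ [kn|->]] := ok e ee; last by rewrite env_one_nil; exact: env_push_nil.
  suff {2}<- : subst_chan rs (lift_chan n sc) (CVar (decl_pos e)) = CVar (decl_pos e).
    exact: env_push_one.
  by rewrite /= /lift_chan kn.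
- move=> Gp X vs cs e eX [em en ek] Gp' rs se sc rX D' eX' pD /=.
  suff -> : D' = env_one (nth (CVar 0) (map (subst_chan rs sc) cs) (decl_pos e)) (decl_tree e).
    by apply: wt_call; [rewrite eX'|rewrite /decl_ok !size_map].
  case: ek pD => [ek|->] pD; last first.
    by rewrite env_one_nil in pD; rewrite env_one_nil; exact: env_push_nilE pD.
  by rewrite (nth_map (CVar 0)) //; exact: env_push_uniq pD (env_push_one _ _ _).
- move=> Gp Gp' rs se sc rX D' _ /env_push_nilE ->; exact: wt_nil.
- move=> Gp P Q D D1 D2 s _ IH1 _ IH2 Gp' rs se sc rX D' eX pD /=.
  have [D1' [D2' [s' p1 p2]]] := env_push_split s pD.
  by apply: wt_par s' _ _; [exact: IH1|exact: IH2].
Qed.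

Lemma lift_chan_CVar n : lift_chan n CVar = CVar.
Proof.
by apply: funext => i; rewrite /lift_chan; case: ltnP => // ni; rewrite subnKC.
Qed.

Lemma shift_chan_CVar : shift_chan \o CVar = CVar.
Proof. by apply: funext. Qed.

Lemma lift_ren_inj n rho : injective rho -> injective (lift_ren n rho).
Proof.
move=> ri x y; rewrite /lift_ren; case: ltnP => xn; case: ltnP => yn.
- by [].
- by move=> e; lia.
- by move=> e; lia.
- by move/addnI/ri; lia.
Qed.

Lemma env_one_comp (f : chan -> chan) c t : injective f ->
  env_one (f c) t \o f = env_one c t.
Proof.
move=> fi; apply: funext => c' /=; case: (pselect (c' = c)) => [->|ne].
  by rewrite !env_one_eq.
by rewrite !env_one_neq // => /fi.
Qed.

Lemma ren_chan_inj rs : injective rs -> injective (subst_chan rs CVar).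
Proof. by move=> ri [i|s r] [j|s' r'] //= [/ri -> ->]. Qed.

(** Congruence is used in both directions, so typings must also be pulled back along renamings. The
    second conclusion recovers freshness: channels in use lie in the image, so a shifted process
    does not use the new session. *)
Lemma wt_ren_inv P : forall Gp Gp' rs se rX D', injective rs ->
  (forall X, Gp' (rX X) = Gp X) -> wt Gp' (subst rs se CVar rX P) D' ->
  wt Gp P (D' \o subst_chan rs CVar) /\
  forall c, D' c <> ltree_nil -> exists c0, c = subst_chan rs CVar c0.
Proof.
elim/proc_ind_In: P.
- move=> c r bs IH Gp Gp' rs se rX D' ri eX /wt_selE[t [-> nbs et wbs]].
  have ci := ren_chan_inj ri; split; last by move=> c' /env_one_supp ->; exists c.
  rewrite env_one_comp //; apply: wt_sel.
  + by move=> bs0; rewrite bs0 in nbs.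
  + by rewrite et /unzip1 -map_comp.
  + move=> l x P inP; rewrite -(env_one_comp _ _ ci).
    apply: (IH (l, (x, P)) inP Gp Gp' rs se rX _ ri eX _).1.
    apply: (wbs l (x.1, subst_expr se x.2)).
    elim: bs inP {IH nbs et wbs} => //= b bs IH [->|/IH]; first by left.
    by right.
- move=> c r bs IH Gp Gp' rs se rX D' ri eX /wt_braE[t [-> nbs et wbs]].
  have ci := ren_chan_inj ri; split; last by move=> c' /env_one_supp ->; exists c.
  rewrite env_one_comp //; apply: wt_bra.
  + by move=> bs0; rewrite bs0 in nbs.
  + by rewrite et /unzip1 -map_comp.
  + move=> l P inP; rewrite -(env_one_comp _ _ ci).
    apply: (IH (l, P) inP Gp Gp' rs _ rX _ ri eX (wbs l _ _)).1.
    elim: bs inP {IH nbs et wbs} => //= b bs IH [->|/IH]; first by left.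
    by right.
- move=> oG P IH Gp Gp' rs se rX D' ri eX /wt_resE[C cC].
  rewrite -/shift_chan shift_chan_CVar => /(IH Gp).
  case=> [|//|wP sD]; first exact: lift_ren_inj.
  split.
    apply: (wt_res _ cC); suff <- : env_res C D' \o subst_chan (lift_ren 1 rs) CVar =
      env_res C (D' \o subst_chan rs CVar) by [].
    by apply: funext => -[i|[|s] r] //=; rewrite /lift_ren /= subn1.
  move=> c; rewrite -(env_res_shift C) => /sD[c0].
  case: (shift_chanP c0) => [[r ->]|[c1 ->]]; first by case: c.
  move=> e; exists c1; apply: shift_chan_inj; rewrite e.
  by case: c1 {e} => //= s r; rewrite /lift_ren /= subn1.
- move=> m n B Q IHB IHQ Gp Gp' rs se rX D' ri eX /wt_defE[oe [ok wB wQ]].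
  have [wQ' sQ] := IHQ _ _ _ _ _ _ ri (decls_cons_lift oe eX) wQ; split=> //.
  apply: wt_def ok _ wQ' => e ee; move: (wB e ee); rewrite lift_chan_CVar => wBe.
  have [] := IHB _ _ _ _ _ _ ri (decls_cons_lift oe eX) wBe.
  rewrite -[CVar _]/(subst_chan rs CVar (CVar (decl_pos e))).
  by rewrite (env_one_comp _ _ (ren_chan_inj ri)).
- move=> X vs cs Gp Gp' rs se rX D' ri eX /wt_callE[e [e1 [em en ek] ->]].
  rewrite !size_map in em en ek.
  have ci := ren_chan_inj ri.
  have -> : env_one (nth (CVar 0) (map (subst_chan rs CVar) cs) (decl_pos e)) (decl_tree e)
    = env_one (subst_chan rs CVar (nth (CVar 0) cs (decl_pos e))) (decl_tree e).
    by case: ek => [ek|->]; [rewrite (nth_map (CVar 0))|rewrite !env_one_nil].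
  rewrite env_one_comp //; split; first by apply: wt_call; rewrite -?eX.
  by move=> c /env_one_supp ->; eexists.
- move=> Gp Gp' rs se rX D' ri eX /wt_nilE ->; split=> //; exact: wt_nil.
- move=> P Q IHP IHQ Gp Gp' rs se rX D' ri eX /wt_parE[D1 [D2 [s wP wQ]]].
  have [wP' s1] := IHP _ _ _ _ _ _ ri eX wP; have [wQ' s2] := IHQ _ _ _ _ _ _ ri eX wQ.
  split; first by apply: wt_par wP' wQ' => c; exact: s.
  by move=> c; case: (s c) => -[e1 e2 nc]; [apply: s1; rewrite e1|apply: s2; rewrite e2].
Qed.

End Typing.

(** * Structural congruence and subject reduction *)

Section Congruence.
Variables (R : realType) (bsort bval : Type).
Notation proc := (proc R bsort bval).
Implicit Types (P Q : proc) (Gp : decls) (D : env).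

Lemma wt_ren Gp Gp' P rs se rX D : injective rs -> (forall X, Gp' (rX X) = Gp X) ->
  (forall c, D c <> ltree_nil -> exists c0, c = subst_chan rs CVar c0) ->
  wt Gp P (D \o subst_chan rs CVar) <-> wt Gp' (subst rs se CVar rX P) D.
Proof.
move=> ri eX sD; split=> [wP|/(wt_ren_inv ri eX)[]//].
apply: (wt_subst wP) => //; split=> // [c nc|c1 c2 _ _ /(ren_chan_inj ri)//].
by have [c0 e] := sD c nc; exists c0; rewrite /= -?e.
Qed.

Lemma subst_chan_id : subst_chan id CVar = id.
Proof. by apply: funext => -[]. Qed.

Lemma wt_ren_pvar Gp Gp' P rX D : (forall X, Gp' (rX X) = Gp X) ->
  wt Gp P D <-> wt Gp' (ren_pvar rX P) D.
Proof.
move=> eX; have {1}-> : D = D \o subst_chan id CVar by rewrite subst_chan_id.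
by apply: wt_ren => // c _; exists c; rewrite subst_chan_id.
Qed.

Lemma wt_ren_pvarS oe Gp P D :
  wt Gp P D <-> wt (decls_cons oe Gp) (ren_pvar S P) D.
Proof. exact: wt_ren_pvar. Qed.

(** A declaration body uses at most a formal, and a renaming of sessions fixes channel variables. *)
Lemma wt_ren_body Gp P rs k t : injective rs ->
  wt Gp P (env_one (CVar k) t) <-> wt Gp (ren_sess rs P) (env_one (CVar k) t).
Proof.
move=> ri; rewrite -{1}(env_one_comp _ _ (ren_chan_inj ri)).
by apply: wt_ren => // c /env_one_supp ->; exists (CVar k).
Qed.

Lemma wt_ren_shift Gp P D :
  wt Gp P D <-> wt Gp (ren_sess S P) (env_res (fun=> ltree_nil) D).
Proof.
have {1}-> : D = env_res (fun=> ltree_nil) D \o shift_chan.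
  by apply: funext => c; rewrite /= env_res_shift.
apply: wt_ren => // [|c]; first exact: succn_inj.
by case: (shift_chanP c) => [[r ->//]|[c' ->]] _; exists c'.
Qed.

Lemma swap01K : involutive swap01.
Proof. by case=> [|[|x]]. Qed.

Lemma wt_swap Gp P C C' D : wt Gp P (env_res C (env_res C' D)) <->
  wt Gp (ren_sess swap01 P) (env_res C' (env_res C D)).
Proof.
have -> : env_res C (env_res C' D) =
    env_res C' (env_res C D) \o subst_chan swap01 CVar.
  by apply: funext => -[i|[|[|s]] r].
apply: wt_ren => //; first exact: inv_inj swap01K.
by move=> c _; exists (subst_chan swap01 CVar c); case: c => //= s r; rewrite swap01K.
Qed.

Lemma env_res_split C D D1 D2 : env_split D D1 D2 ->
  env_split (env_res C D) (env_res C D1) (env_res (fun=> ltree_nil) D2).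
Proof.
by move=> s c; case: (shift_chanP c) => [[r ->]|[c' ->]]; [left|rewrite !env_res_shift].
Qed.

Lemma env_res_comp C D : env_res C D \o shift_chan = D.
Proof. by apply: funext => c; rewrite /= env_res_shift. Qed.

Lemma wt_par_comm Gp P Q D : wt Gp (PPar P Q) D -> wt Gp (PPar Q P) D.
Proof.
by move=> /wt_parE[D1 [D2 [/env_split_sym s wP wQ]]]; apply: wt_par s wQ wP.
Qed.

Lemma wt_parA Gp P Q U D : wt Gp (PPar (PPar P Q) U) D -> wt Gp (PPar P (PPar Q U)) D.
Proof.
move=> /wt_parE[D12 [D3 [s /wt_parE[D1 [D2 [s' wP wQ]]] wU]]].
have [D23 s1 s2] := env_splitA s s'.
by apply: wt_par s1 wP _; apply: wt_par s2 wQ wU.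
Qed.

(** From right to left, the whole family of session 0 must lie on the side of [P], since a shifted
    process cannot use that session. *)
Lemma wt_res_par Gp oG P Q D :
  wt Gp (PPar (PRes oG P) Q) D <-> wt Gp (PRes oG (PPar P (ren_sess S Q))) D.
Proof.
split=> [/wt_parE[D1 [D2 [s /wt_resE[C cC wP] wQ]]]|].
  apply: (wt_res _ cC); apply: wt_par (env_res_split C s) wP _.
  by rewrite -wt_ren_shift.
move=> /wt_resE[C cC /wt_parE[E1 [E2 [s wP wQ]]]].
have [wQ' sE2] := wt_ren_inv (Gp := Gp) succn_inj (fun=> erefl) wQ.
apply: (@wt_par _ _ _ _ _ _ _ (E1 \o shift_chan) (E2 \o shift_chan)) => //.
  by move=> c; have := s (shift_chan c); rewrite env_res_shift.
apply: (wt_res _ cC); suff <- : E1 = env_res C (E1 \o shift_chan) by [].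
apply: funext => c; case: (shift_chanP c) => [[r ->]|[c' ->]]; last by rewrite env_res_shift.
case: (s (CSess 0 r)) => -[e1 e2] //; rewrite e1.
case: (pselect (E2 (CSess 0 r) = ltree_nil)) => [e|/sE2[[]//]].
by rewrite -e e2.
Qed.

Lemma wt_def_res Gp m n B oG P D : wt Gp (PDef m n B (PRes oG P)) D <->
  wt Gp (PRes oG (PDef m n (ren_sess S B) P)) D.
Proof.
split=> [/wt_defE[oe [ok wB /wt_resE[C cC wP]]]|/wt_resE[C cC /wt_defE[oe [ok wB wP]]]].
  apply: (wt_res _ cC); apply: wt_def ok _ wP => e /wB.
  by rewrite (wt_ren_body _ _ _ _ succn_inj).
apply: wt_def ok _ (wt_res _ cC wP) => e /wB.
by rewrite -(wt_ren_body _ _ _ _ succn_inj).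
Qed.

Lemma wt_def_par Gp m n B P Q D : wt Gp (PDef m n B (PPar P (ren_pvar S Q))) D <->
  wt Gp (PPar (PDef m n B P) Q) D.
Proof.
split=> [/wt_defE[oe [ok wB /wt_parE[D1 [D2 [s wP wQ]]]]]|].
  apply: wt_par s (wt_def ok wB wP) _.
  by rewrite (wt_ren_pvarS oe).
move=> /wt_parE[D1 [D2 [s /wt_defE[oe [ok wB wP]] wQ]]].
apply: wt_def ok wB _; apply: wt_par s wP _.
by rewrite -wt_ren_pvarS.
Qed.

Lemma wt_def_def Gp m n B m' n' B' P D :
  wt Gp (PDef m n B (PDef m' n' (ren_pvar (lift_ren 1 S) B') P)) D <->
  wt Gp (PDef m' n' B' (PDef m n (ren_pvar (lift_ren 1 S) B) (ren_pvar swap01 P))) D.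
Proof.
have lift oe oe' Q E : wt (decls_cons oe Gp) Q E <->
    wt (decls_cons oe (decls_cons oe' Gp)) (ren_pvar (lift_ren 1 S) Q) E.
  by apply: wt_ren_pvar => -[|X] //=; rewrite /lift_ren /= subn1.
have swap oe oe' E : wt (decls_cons oe' (decls_cons oe Gp)) P E <->
    wt (decls_cons oe (decls_cons oe' Gp)) (ren_pvar swap01 P) E.
  by apply: wt_ren_pvar => -[|[|X]].
split=> /wt_defE[oe [ok wB /wt_defE[oe' [ok' wB' wP]]]].
  apply: (wt_def ok'); first by move=> e /wB'; rewrite -lift.
  by apply: (wt_def ok); [move=> e /wB; rewrite -lift|rewrite -swap].
apply: (wt_def ok'); first by move=> e /wB'; rewrite -lift.
by apply: (wt_def ok); [move=> e /wB; rewrite -lift|rewrite swap].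
Qed.

(** The delicate rules are those that erase a binder, read from right to left. They introduce a
    restriction, which the empty family types whatever its annotation, and a declaration, which is
    given [None] so that its body need not be typable. *)
Lemma wt_scong P Q : scong P Q -> forall Gp D, wt Gp P D <-> wt Gp Q D.
Proof.
elim=> {P Q}.
- by move=> P Q Gp D; split; exact: wt_par_comm.
- move=> P Q U Gp D; split; first exact: wt_parA.
  by move=> /wt_par_comm/wt_parA/wt_par_comm/wt_parA/wt_par_comm.
- move=> P Gp D; split; last first.
    by move=> wP; apply: wt_par (env_split_nilr D) wP (wt_nil _ _ _ _).
  by move=> /wt_parE[D1 [D2 [s wP /wt_nilE e]]]; move: s; rewrite e => /env_split_nil <-.
- move=> oG _ Gp D; split=> [/wt_resE[C _ /wt_nilE e]|/wt_nilE ->].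
    have -> : D = env_nil by rewrite -(env_res_comp C D) e.
    exact: wt_nil.
  apply: (wt_res _ coherent_nil).
  have -> : env_res (fun=> ltree_nil) env_nil = env_nil by apply: funext => -[i|[]].
  exact: wt_nil.
- move=> oG oG' P Gp D; split=> /wt_resE[C cC /wt_resE[C' cC' wP]];
    apply: (wt_res _ cC'); apply: (wt_res _ cC); first by rewrite -wt_swap.
  by rewrite wt_swap.
- by move=> oG P Q Gp D; exact: wt_res_par.
- move=> m n B _ _ Gp D; split=> [/wt_defE[oe [_ _ /wt_nilE ->]]|/wt_nilE ->].
    exact: wt_nil.
  by apply: (@wt_def _ _ _ _ _ _ _ _ None) => //; exact: wt_nil.
- by move=> *; exact: wt_def_res.
- by move=> *; exact: wt_def_par.
- by move=> *; exact: wt_def_def.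
- by [].
- by move=> P Q _ IH Gp D; rewrite IH.
- by move=> P Q U _ IH1 _ IH2 Gp D; rewrite IH1.
- move=> c r bs l p e P P' bs' _ IH Gp D.
  have dir (Q Q' : proc) : (forall Gp D, wt Gp Q D -> wt Gp Q' D) ->
      wt Gp (PSel c r (bs ++ (l, (p, e, Q)) :: bs')) D ->
      wt Gp (PSel c r (bs ++ (l, (p, e, Q')) :: bs')) D.
    move=> QQ' /wt_selE[t [-> _ et wbs]]; apply: wt_sel.
    - by case: (bs).
    - by rewrite et /unzip1 !map_cat.
    - move=> l0 x U /In_cat[inU|[[<- _ <-]|inU]].
      + by apply: (wbs l0 x); apply/In_cat; left.
      + by apply/QQ'/(wbs l (p, e)); apply/In_cat; right; left.
      + by apply: (wbs l0 x); apply/In_cat; right; right.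
  by split; apply: dir => ? ?; rewrite IH.
- move=> c r bs l P P' bs' _ IH Gp D.
  have dir (Q Q' : proc) : (forall Gp D, wt Gp Q D -> wt Gp Q' D) ->
      wt Gp (PBra c r (bs ++ (l, Q) :: bs')) D ->
      wt Gp (PBra c r (bs ++ (l, Q') :: bs')) D.
    move=> QQ' /wt_braE[t [-> _ et wbs]]; apply: wt_bra.
    - by case: (bs).
    - by rewrite et /unzip1 !map_cat.
    - move=> l0 U /In_cat[inU|[[<- <-]|inU]].
      + by apply: (wbs l0); apply/In_cat; left.
      + by apply/QQ'/(wbs l); apply/In_cat; right; left.
      + by apply: (wbs l0); apply/In_cat; right; right.
  by split; apply: dir => ? ?; rewrite IH.
- by move=> oG P P' _ IH Gp D; split=> /wt_resE[C cC wP]; apply: (wt_res _ cC); apply/IH.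
- move=> m n B B' Q Q' _ IHB _ IHQ Gp D; split=> /wt_defE[oe [ok wB wQ]];
    apply: (wt_def ok); try (by apply/IHQ); by move=> e /wB/IHB.
- by move=> P P' Q Q' _ IHP _ IHQ Gp D; split=> /wt_parE[D1 [D2 [s wP wQ]]];
    apply: wt_par s _ _; first [exact/IHP|exact/IHQ].
Qed.

(** * Subject reduction *)

Definition env_comm (s : nat) (a b : role) (l : label) (D : env) : env := fun c =>
  if c is CSess s' q then if s' == s then role_comm a b l q (D c) else D c else D c.

(** Both endpoints lie in [D1], so the communication leaves [D2] alone. *)
Lemma env_comm_split s a b l D D1 D2 ha hb : env_split D D1 D2 ->
  D1 (CSess s a) [::] = Some ha -> D1 (CSess s b) [::] = Some hb ->
  env_split (env_comm s a b l D) (env_comm s a b l D1) D2.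
Proof.
move=> sD ea eb; have other q h : D1 (CSess s q) [::] = Some h ->
    D1 (CSess s q) = D (CSess s q) /\ D2 (CSess s q) = ltree_nil.
  by case: (sD (CSess s q)) => -[e1 e2] //; rewrite e1.
case=> [i|s' q] /=; first exact: sD.
case: eqP => [->|_]; last exact: sD.
rewrite /role_comm; case: eqP => [->|_] /=; first by have [-> ->] := other _ _ ea; left.
by case: eqP => [->|_] /=; [have [-> ->] := other _ _ eb; left|exact: sD].
Qed.

Definition env_enabled (s : nat) (a b : role) (l : label) (D : env) : Prop :=
  exists La Lb, [/\ D (CSess s a) [::] = Some (HSel b La),
    D (CSess s b) [::] = Some (HBra a Lb) & l \in La].

(** A call, or a communication on a session restricted inside, keeps the environment. A
    communication on a free session is passed outwards through the context until it meets its
    restriction, where [coherent_comm] absorbs it. *)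
Lemma step_wt norm P tl p P' : step norm P tl p P' -> forall Gp D, wt Gp P D ->
  wt Gp P' D \/
  exists s a b l, env_enabled s a b l D /\ wt Gp P' (env_comm s a b l D).
Proof.
elim=> {P tl p P'}.
- move=> s r1 r2 bs bs' l p v P P' sub inP inP' Gp D /wt_parE[D1 [D2 [sp]]].
  move=> /wt_selE[t [e1 _ et wbs]] /wt_braE[t' [e2 _ et' wbs']]; subst D1 D2; right.
  (* A split never gives a used channel to both sides. *)
  have nr : r1 <> r2.
    move=> er; move: (sp (CSess s r1)); rewrite {2 4}er !env_one_eq.
    by case=> -[e1 e2]; [move: et'; rewrite e2|move: et; rewrite e1].
  have d1 : D (CSess s r1) = t.
    by move: (sp (CSess s r1)); rewrite env_one_eq => -[[->//]|[e]]; rewrite e in et.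
  have d2 : D (CSess s r2) = t'.
    by move: (sp (CSess s r2)); rewrite env_one_eq => -[[_ e]|[_ ->//]]; rewrite e in et'.
  exists s, r1, r2, l; split.
    by exists (unzip1 bs), (unzip1 bs'); rewrite d1 d2; split=> //; exact: In_unzip1 inP.
  apply: (wt_par (D2 := env_one (CSess s r2) (ltree_at l t')) _ (wbs _ _ _ inP)); last first.
    apply: (wt_subst (wbs' _ _ inP')) => //.
    suff {2}<- : subst_chan id (inst_chan [::]) (CSess s r2) = CSess s r2.
      exact: env_push_one.
    by [].
  case=> [i|s' q] /=.
    by move: (sp (CVar i)); rewrite !env_one_neq.
  case: (eqVneq s' s) => [->|/eqP ns]; last first.
    by move: (sp (CSess s' q)); rewrite !env_one_neq => // -[].
  rewrite /role_comm; case: (eqVneq q r1) => [->|/eqP n1] /=.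
    by rewrite d1 env_one_eq env_one_neq; [left|case].
  case: (eqVneq q r2) => [->|/eqP n2] /=.
    by rewrite d2 env_one_eq env_one_neq; [right|case=> /esym].
  by move: (sp (CSess s q)); rewrite !env_one_neq => // -[].
- move=> m n B vs cs Q em en Gp D /wt_defE[oe [ok wB]].
  move=> /wt_parE[D1 [D2 [sp /wt_callE[e [/= eoe _ e1]] wQ]]]; left.
  have [_ en' ek] := ok e eoe; have wBe := wB e eoe.
  apply: (wt_def ok wB); apply: wt_par sp _ wQ.
  apply: (wt_subst wBe) => //; rewrite e1.
  case: ek => [ek|->]; last by rewrite !env_one_nil; exact: env_push_nil.
  suff -> : nth (CVar 0) cs (decl_pos e) =
      subst_chan id (inst_chan cs) (CVar (decl_pos e)) by exact: env_push_one.
  (* The defaults of [inst_chan] and [wt_call] differ, but the position is in range. *)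
  by rewrite /= /inst_chan; apply: set_nth_default; rewrite en.
- move=> E P tl p P' _ IH; elim: E => [|E IHE Q|Q E IHE|oG E IHE|m n B E IHE] //= Gp D.
  + move=> /wt_parE[D1 [D2 [sp /IHE[wP|[s [a [b [l [[La [Lb [ea eb lL]]] wP]]]]]] wQ]]].
      by left; exact: wt_par sp wP wQ.
    right; exists s, a, b, l; split; last by apply: wt_par wP wQ; exact: env_comm_split ea eb.
    exists La, Lb; split=> //.
      by case: (sp (CSess s a)) => [[<- //]|[e]]; rewrite e in ea.
    by case: (sp (CSess s b)) => [[<- //]|[e]]; rewrite e in eb.
  + move=> /wt_par_comm/wt_parE[D1 [D2 [sp]]].
    move=> /IHE[wP|[s [a [b [l [[La [Lb [ea eb lL]]] wP]]]]]] wQ.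
      by left; apply/wt_par_comm; exact: wt_par sp wP wQ.
    right; exists s, a, b, l; split; last first.
      by apply/wt_par_comm; apply: wt_par wP wQ; exact: env_comm_split ea eb.
    exists La, Lb; split=> //.
      by case: (sp (CSess s a)) => [[<- //]|[e]]; rewrite e in ea.
    by case: (sp (CSess s b)) => [[<- //]|[e]]; rewrite e in eb.
  + move=> /wt_resE[C cC /IHE[wP|[s [a [b [l [[La [Lb [ea eb lL]]] wP]]]]]]];
      last case: s ea eb wP => [|s] ea eb wP.
    * by left; exact: wt_res cC wP.
    * left; apply: (wt_res _ (coherent_comm cC ea eb lL)).
      suff <- : env_comm 0 a b l (env_res C D) =
        env_res (fun r => role_comm a b l r (C r)) D by [].
      by apply: funext => -[i|[|s] r].
    * right; exists s, a, b, l; split; first by exists La, Lb.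
      apply: (wt_res _ cC); suff <- : env_comm s.+1 a b l (env_res C D) =
        env_res C (env_comm s a b l D) by [].
      by apply: funext => -[i|[|s'] r].
  + move=> /wt_defE[oe [ok wB /IHE[wP|[s [a [b [l [en wP]]]]]]]].
      by left; exact: wt_def ok wB wP.
    by right; exists s, a, b, l; split=> //; exact: wt_def ok wB wP.
- move=> P Q tl p Q' P' PQ _ IH QP' Gp D /(wt_scong PQ)/IH[wQ|[s [a [b [l [en wQ]]]]]].
    by left; apply/(wt_scong QP').
  by right; exists s, a, b, l; split=> //; apply/(wt_scong QP').
Qed.

Lemma step_wt_closed norm P tl p P' Gp : step norm P tl p P' ->
  wt Gp P env_nil -> wt Gp P' env_nil.
Proof.
by move=> st /(step_wt st)[//|[s [a [b [l [[La [Lb []]]]]]]]].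
Qed.

End Congruence.

(** * Well-formedness *)

Import Order.TTheory GRing.Theory Num.Theory.
Local Open Scope ring_scope.

Section WellFormed.
Variables (R : realType) (bsort bval : Type).
Notation proc := (proc R bsort bval).
Implicit Types (P Q : proc).

Lemma all_In (A : Type) (a : A -> bool) s : all a s <-> forall x, List.In x s -> a x.
Proof.
elim: s => //= x s IH; split=> [/andP[ax /IH h] y [<-//|/h//]|h].
by apply/andP; split; [apply: h; left|apply/IH => y ?; apply: h; right].
Qed.

Lemma scoped_subst P : forall ns nb nc ns' nb' nc' rs se sc rX, scoped ns nb nc P ->
  (forall s, (s < ns)%N -> (rs s < ns')%N) ->
  (forall i, (i < nb)%N -> scoped_expr nb' (se i)) ->
  (forall i, (i < nc)%N -> scoped_chan ns' nc' (sc i)) ->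
  scoped ns' nb' nc' (subst rs se sc rX P).
Proof.
have sE nb nb' (se : nat -> expr bval) e : scoped_expr nb e ->
    (forall i, (i < nb)%N -> scoped_expr nb' (se i)) -> scoped_expr nb' (subst_expr se e).
  by case: e => //= i ib; apply.
have sC ns nc ns' nc' rs sc c : scoped_chan ns nc c ->
    (forall s, (s < ns)%N -> (rs s < ns')%N) ->
    (forall i, (i < nc)%N -> scoped_chan ns' nc' (sc i)) ->
    scoped_chan ns' nc' (subst_chan rs sc c).
  by case: c => /= [i ic _|s r sn h _]; [apply|exact: h].
have lE m nb nb' (se : nat -> expr bval) :
    (forall i, (i < nb)%N -> scoped_expr nb' (se i)) ->
    forall i, (i < m + nb)%N -> scoped_expr (m + nb') (lift_expr m se i).
  move=> h i im; rewrite /lift_expr; case: ltnP => im'; first by rewrite /=; lia.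
  by have := h (i - m)%N; case: (se _) => //= j hj; rewrite ltn_add2l hj //; lia.
elim/proc_ind_In: P.
- move=> c r bs IH ns nb nc ns' nb' nc' rs se sc rX /= /andP[sc0 /all_In sbs] hs hb hc.
  rewrite (sC _ _ _ _ _ _ _ sc0 hs hc) all_map; apply/all_In => b inb /=.
  have /andP[s1 s2] := sbs b inb.
  by rewrite (sE _ _ _ _ s1 hb) (IH b inb _ _ _ _ _ _ _ _ _ _ s2).
- move=> c r bs IH ns nb nc ns' nb' nc' rs se sc rX /= /andP[sc0 /all_In sbs] hs hb hc.
  rewrite (sC _ _ _ _ _ _ _ sc0 hs hc) all_map; apply/all_In => b inb /=.
  by apply: (IH b inb _ _ _ _ _ _ _ _ _ _ (sbs b inb)) => //; exact: (lE 1%N).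
- move=> oG P IH ns nb nc ns' nb' nc' rs se sc rX /= sP hs hb hc.
  apply: (IH _ _ _ _ _ _ _ _ _ _ sP) => //.
    by move=> [|s] //=; rewrite /lift_ren /= subn1 => /hs.
  by move=> i /hc /=; case: (sc i).
- move=> m n B Q IHB IHQ ns nb nc ns' nb' nc' rs se sc rX /= /andP[sB sQ] hs hb hc.
  apply/andP; split; last exact: IHQ sQ _ _ _.
  apply: (IHB _ _ _ _ _ _ _ _ _ _ sB) => //; first exact: lE.
  move=> i im; rewrite /lift_chan; case: ltnP => im'; first by rewrite /=; lia.
  have := hc (i - n)%N; case: (sc _) => //= j => [|hj] hj'.
    by rewrite ltn_add2l hj' //; lia.
  by apply: hj'; lia.
- move=> X vs cs ns nb nc ns' nb' nc' rs se sc rX /= /andP[/all_In sv /all_In scs] hs hb hc.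
  by rewrite !all_map; apply/andP; split; apply/all_In => x inx /=;
    [exact: sE (sv x inx) hb|exact: sC (scs x inx) hs hc].
- by [].
- move=> P Q IHP IHQ ns nb nc ns' nb' nc' rs se sc rX /= /andP[sP sQ] hs hb hc.
  by apply/andP; split; [exact: IHP sP _ _ _|exact: IHQ sQ _ _ _].
Qed.

Lemma lift_expr_EVar n : lift_expr n (@EVar bval) = EVar.
Proof.
by apply: funext => i; rewrite /lift_expr; case: ltnP => // ni; rewrite subnKC.
Qed.

Lemma subst_expr_EVar (e : expr bval) : subst_expr EVar e = e.
Proof. by case: e. Qed.

Lemma scoped_ren_inv P : forall ns nb nc ns' rs rX,
  (forall s, (rs s < ns')%N -> (s < ns)%N) ->
  scoped ns' nb nc (subst rs EVar CVar rX P) -> scoped ns nb nc P.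
Proof.
have sC ns nc ns' rs c : (forall s, (rs s < ns')%N -> (s < ns)%N) ->
    scoped_chan ns' nc (subst_chan rs CVar c) -> scoped_chan ns nc c.
  by case: c => //= s r; apply.
elim/proc_ind_In: P.
- move=> c r bs IH ns nb nc ns' rs rX hs /= /andP[/(sC _ _ _ _ _ hs) ->].
  rewrite all_map => /all_In sbs; apply/all_In => b inb.
  move: (sbs b inb) => /=; rewrite subst_expr_EVar => /andP[-> /=].
  exact: IH.
- move=> c r bs IH ns nb nc ns' rs rX hs /= /andP[/(sC _ _ _ _ _ hs) ->].
  rewrite all_map => /all_In sbs; apply/all_In => b inb.
  move: (sbs b inb) => /=; rewrite lift_expr_EVar; exact: IH.
- move=> oG P IH ns nb nc ns' rs rX hs /=; rewrite -/shift_chan shift_chan_CVar.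
  by apply: IH => -[|s] //; rewrite /lift_ren /= subn1 => /hs.
- move=> m n B Q IHB IHQ ns nb nc ns' rs rX hs /=.
  rewrite lift_chan_CVar lift_expr_EVar => /andP[sB sQ].
  by rewrite (IHB _ _ _ _ _ _ hs sB) (IHQ _ _ _ _ _ _ hs sQ).
- move=> X vs cs ns nb nc ns' rs rX hs /=; rewrite !all_map => /andP[/all_In sv /all_In sc].
  apply/andP; split; apply/all_In => x inx.
    by move: (sv x inx); rewrite /= subst_expr_EVar.
  exact: sC (sc x inx).
- by [].
- move=> P Q IHP IHQ ns nb nc ns' rs rX hs /= /andP[sP sQ].
  by rewrite (IHP _ _ _ _ _ _ hs sP) (IHQ _ _ _ _ _ _ hs sQ).
Qed.

Lemma wf_PSelE c r (bs : seq (label * (R * expr bval * proc))) : wf_proc (PSel c r bs) ->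
  [/\ wf_family bs, forall l p e P, List.In (l, (p, e, P)) bs -> 0 <= p <= 1 &
    forall l p e P, List.In (l, (p, e, P)) bs -> wf_proc P].
Proof. by move=> w; inversion w. Qed.

Lemma wf_PBraE c r (bs : seq (label * proc)) : wf_proc (PBra c r bs) ->
  wf_family bs /\ forall l P, List.In (l, P) bs -> wf_proc P.
Proof. by move=> w; inversion w. Qed.

Lemma wf_PResE oG P : wf_proc (PRes oG P) -> wf_annot oG /\ wf_proc P.
Proof. by move=> w; inversion w. Qed.

Lemma wf_PDefE m n B Q : wf_proc (PDef m n B Q) ->
  [/\ closed_decl m n B, wf_proc B & wf_proc Q].
Proof. by move=> w; inversion w. Qed.

Lemma wf_PParE P Q : wf_proc (PPar P Q) -> wf_proc P /\ wf_proc Q.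
Proof. by move=> w; inversion w. Qed.

Lemma wf_family_unzip1 (A B : Type) (s : seq (label * A)) (t : seq (label * B)) :
  unzip1 s = unzip1 t -> wf_family s = wf_family t.
Proof.
rewrite /wf_family => e; rewrite e; congr (~~ _ && _).
by move/(congr1 size): e; rewrite !size_map /nilp => ->.
Qed.

Lemma In_map (A B : Type) (f : A -> B) y s :
  List.In y (map f s) <-> exists2 x, List.In x s & y = f x.
Proof.
split; elim: s => [|x s IH] //=.
- by case=> [<-|/IH[z zs ->]]; [exists x; [left|]|exists z; [right|]].
- by case.
- case=> z [<- ->|zs ez]; first by left.
  by right; apply: IH; exists z.
Qed.

Lemma wf_subst P : wf_proc P -> forall rs se sc rX, wf_proc (subst rs se sc rX P).
Proof.
elim=> {P}.
- move=> c r bs wbs pbs _ IH rs se sc rX /=; apply: wf_PSel.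
  + by rewrite -(@wf_family_unzip1 _ _ bs) // /unzip1 -map_comp.
  + move=> l p e P /In_map[[l' [[p' e'] P']] inP [_ -> _ _]]; exact: pbs inP.
  + move=> l p e P /In_map[[l' [[p' e'] P']] inP [_ _ _ ->]]; exact: IH inP _ _ _ _.
- move=> c r bs wbs _ IH rs se sc rX /=; apply: wf_PBra.
  + by rewrite -(@wf_family_unzip1 _ _ bs) // /unzip1 -map_comp.
  + move=> l P /In_map[[l' P'] inP [_ ->]]; exact: IH inP _ _ _ _.
- by move=> oG P wG _ IH rs se sc rX; apply: wf_PRes.
- move=> m n B Q cB _ IHB _ IHQ rs se sc rX /=; apply: wf_PDef => //.
  apply: scoped_subst cB _ _ _ => // i im; rewrite /lift_expr ?/lift_chan im //.
- by move=> X vs cs rs se sc rX; exact: wf_PCall.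
- by move=> rs se sc rX; exact: wf_PNil.
- by move=> P Q _ IHP _ IHQ rs se sc rX; exact: wf_PPar.
Qed.

Lemma wf_ren_inv P : forall rs rX, wf_proc (subst rs EVar CVar rX P) -> wf_proc P.
Proof.
elim/proc_ind_In: P.
- move=> c r bs IH rs rX /= /wf_PSelE[wbs pbs IH']; apply: wf_PSel.
  + by move: wbs; rewrite -(@wf_family_unzip1 _ _ bs) // /unzip1 -map_comp.
  + by move=> l p e P inP; eapply pbs; apply/In_map; exists (l, (p, e, P)).
  + move=> l p e P inP; apply: (IH (l, (p, e, P)) inP rs rX).
    by eapply IH'; apply/In_map; exists (l, (p, e, P)).
- move=> c r bs IH rs rX /= /wf_PBraE[wbs IH']; apply: wf_PBra.
  + by move: wbs; rewrite -(@wf_family_unzip1 _ _ bs) // /unzip1 -map_comp.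
  + move=> l P inP; apply: (IH (l, P) inP rs rX); rewrite -(lift_expr_EVar 1).
    by eapply IH'; apply/In_map; exists (l, P).
- move=> oG P IH rs rX /= /wf_PResE[wG].
  by rewrite -/shift_chan shift_chan_CVar => /IH; exact: wf_PRes.
- move=> m n B Q IHB IHQ rs rX /= /wf_PDefE[].
  rewrite lift_chan_CVar lift_expr_EVar => cB /IHB wB /IHQ wQ; apply: wf_PDef => //.
  by apply: scoped_ren_inv cB.
- by move=> *; exact: wf_PCall.
- by move=> *; exact: wf_PNil.
- by move=> P Q IHP IHQ rs rX /= /wf_PParE[/IHP wP /IHQ wQ]; exact: wf_PPar.
Qed.

Lemma wf_ren rs rX P : wf_proc (subst rs EVar CVar rX P) <-> wf_proc P.
Proof. by split=> [/wf_ren_inv|w] //; exact: wf_subst. Qed.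

Lemma closed_ren rs rX m n P :
  closed_decl m n (subst rs EVar CVar rX P) <-> closed_decl m n P.
Proof.
split; first exact: scoped_ren_inv.
by move=> cP; apply: scoped_subst cP _ _ _.
Qed.

Lemma wf_PDefP m n B Q : wf_proc (PDef m n B Q) <->
  closed_decl m n B /\ wf_proc B /\ wf_proc Q.
Proof. by split=> [/wf_PDefE[]//|[? [? ?]]]; exact: wf_PDef. Qed.

Lemma wf_PParP P Q : wf_proc (PPar P Q) <-> wf_proc P /\ wf_proc Q.
Proof. by split=> [/wf_PParE//|[? ?]]; exact: wf_PPar. Qed.

Lemma wf_PResP oG P : wf_proc (PRes oG P) <-> wf_annot oG /\ wf_proc P.
Proof. by split=> [/wf_PResE//|[? ?]]; exact: wf_PRes. Qed.

Lemma scoped_ren ns ns' nb nc rs rX P : (forall s, (rs s < ns')%N = (s < ns)%N) ->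
  scoped ns' nb nc (subst rs EVar CVar rX P) = scoped ns nb nc P.
Proof.
move=> hs; apply/idP/idP; first by apply: scoped_ren_inv => s; rewrite hs.
by move=> sP; apply: scoped_subst sP _ _ _ => // s; rewrite hs.
Qed.

Lemma scopedW P : forall ns nb nc ns' nb' nc',
  (ns <= ns')%N -> (nb <= nb')%N -> (nc <= nc')%N ->
  scoped ns nb nc P -> scoped ns' nb' nc' P.
Proof.
have sC ns nc ns' nc' c : (ns <= ns')%N -> (nc <= nc')%N ->
    scoped_chan ns nc c -> scoped_chan ns' nc' c.
  by case: c => [i|s r] h1 h2 /leq_trans; apply.
have sE nb nb' (e : expr bval) : (nb <= nb')%N -> scoped_expr nb e -> scoped_expr nb' e.
  by case: e => //= i h /leq_trans; apply.
elim/proc_ind_In: P => [c r bs IH|c r bs IH|oG P IH|m n B Q IHB IHQ|X vs cs||P Q IHP IHQ]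
  ns nb nc ns' nb' nc' hs hb hc //=.
- move=> /andP[/(sC _ _ _ _ _ hs hc) -> /all_In sbs]; apply/all_In => b inb /=.
  have /andP[/(sE _ _ _ hb) -> s2] := sbs b inb; exact: IH s2.
- move=> /andP[/(sC _ _ _ _ _ hs hc) -> /all_In sbs]; apply/all_In => b inb /=.
  by apply: (IH _ inb _ _ _ _ _ _ _ _ _ (sbs b inb)).
- exact: IH.
- by move=> /andP[sB sQ]; rewrite (IHQ ns nb nc) // andbT; apply: IHB sB; rewrite ?leq_add2l.
- move=> /andP[/all_In sv /all_In sc]; apply/andP; split; apply/all_In => x inx.
    exact: sE hb (sv x inx).
  exact: sC hs hc (sc x inx).
- by move=> /andP[sP sQ]; rewrite (IHP ns nb nc) // (IHQ ns nb nc).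
Qed.

(** A congruence inside a declaration body must keep the body closed. *)
Lemma scoped_scong P Q : scong P Q -> forall ns nb nc, scoped ns nb nc P = scoped ns nb nc Q.
Proof.
elim=> {P Q} /=.
- by move=> P Q ns nb nc; rewrite andbC.
- by move=> P Q U ns nb nc; rewrite andbA.
- by move=> P ns nb nc; rewrite andbT.
- by [].
- move=> oG oG' P ns nb nc; rewrite (scoped_ren (ns := ns.+2)) //.
  by case=> [|[|s]].
- by move=> oG P Q ns nb nc; rewrite (scoped_ren (ns := ns)).
- by move=> m n B cB _ ns nb nc; rewrite (scopedW _ _ _ cB) // leq_addr.
- by move=> m n B oG P ns nb nc; rewrite (scoped_ren (ns := ns)).
- by move=> m n B P Q ns nb nc; rewrite (scoped_ren (ns := ns)) // andbA.
- by move=> m n B m' n' B' P ns nb nc; rewrite !(scoped_ren (ns := ns)) // andbCA.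
- by [].
- by move=> P Q _ IH ns nb nc; rewrite IH.
- by move=> P Q U _ IH1 _ IH2 ns nb nc; rewrite IH1.
- by move=> c r bs l p e P P' bs' _ IH ns nb nc; rewrite !all_cat /= IH.
- by move=> c r bs l P P' bs' _ IH ns nb nc; rewrite !all_cat /= IH.
- by move=> oG P P' _ IH ns nb nc; rewrite IH.
- by move=> m n B B' Q Q' _ IHB _ IHQ ns nb nc; rewrite IHB IHQ.
- by move=> P P' Q Q' _ IHP _ IHQ ns nb nc; rewrite IHP IHQ.
Qed.

(** To reach [PNil], the remaining binders are erased by [sc_res_nil] and [sc_def_nil], which
    require well-formed annotations and bodies; hence well-formedness is carried along congruence
    and reduction. *)
Lemma wf_scong P Q : scong P Q -> wf_proc P <-> wf_proc Q.
Proof.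
elim=> {P Q}.
- by move=> P Q; rewrite !wf_PParP; tauto.
- by move=> P Q U; rewrite !wf_PParP; tauto.
- by move=> P; rewrite wf_PParP; split=> [[]//|wP]; split=> //; exact: wf_PNil.
- by move=> oG wG; split=> _; [exact: wf_PNil|apply: wf_PRes => //; exact: wf_PNil].
- by move=> oG oG' P; rewrite /ren_sess !wf_PResP wf_ren; tauto.
- by move=> oG P Q; rewrite /ren_sess !(wf_PParP, wf_PResP) wf_ren; tauto.
- by move=> m n B cB wB; split=> _; [exact: wf_PNil|apply: wf_PDef => //; exact: wf_PNil].
- move=> m n B oG P; rewrite /ren_sess !(wf_PDefP, wf_PResP) wf_ren closed_ren; tauto.
- move=> m n B P Q; rewrite /ren_pvar !(wf_PDefP, wf_PParP) wf_ren; tauto.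
- move=> m n B m' n' B' P; rewrite /ren_pvar !wf_PDefP !wf_ren !closed_ren; tauto.
- by [].
- by move=> P Q _ ->.
- by move=> P Q U _ -> _ ->.
- move=> c r bs l p e P P' bs' _ IH.
  have dir (Q Q' : proc) : (wf_proc Q -> wf_proc Q') ->
      wf_proc (PSel c r (bs ++ (l, (p, e, Q)) :: bs')) ->
      wf_proc (PSel c r (bs ++ (l, (p, e, Q')) :: bs')).
    move=> QQ' /wf_PSelE[wbs pbs IH']; apply: wf_PSel.
    - by rewrite (wf_family_unzip1 (t := bs ++ (l, (p, e, Q)) :: bs')) // /unzip1 !map_cat.
    - move=> l0 p0 e0 P0 /In_cat[inP|[[_ <- _ _]|inP]].
      + by eapply pbs; apply/In_cat; left; eassumption.
      + by eapply pbs; apply/In_cat; right; left; reflexivity.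
      + by eapply pbs; apply/In_cat; right; right; eassumption.
    - move=> l0 p0 e0 P0 /In_cat[inP|[[_ _ _ <-]|inP]].
      + by eapply IH'; apply/In_cat; left; eassumption.
      + by apply: QQ'; eapply IH'; apply/In_cat; right; left; reflexivity.
      + by eapply IH'; apply/In_cat; right; right; eassumption.
  by split; apply: dir; rewrite IH.
- move=> c r bs l P P' bs' _ IH.
  have dir (Q Q' : proc) : (wf_proc Q -> wf_proc Q') ->
      wf_proc (PBra c r (bs ++ (l, Q) :: bs')) ->
      wf_proc (PBra c r (bs ++ (l, Q') :: bs')).
    move=> QQ' /wf_PBraE[wbs IH']; apply: wf_PBra.
    - by rewrite (wf_family_unzip1 (t := bs ++ (l, Q) :: bs')) // /unzip1 !map_cat.
    - move=> l0 P0 /In_cat[inP|[[_ <-]|inP]].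
      + by eapply IH'; apply/In_cat; left; eassumption.
      + by apply: QQ'; eapply IH'; apply/In_cat; right; left; reflexivity.
      + by eapply IH'; apply/In_cat; right; right; eassumption.
  by split; apply: dir; rewrite IH.
- by move=> oG P P' _ IH; rewrite !wf_PResP IH.
- move=> m n B B' Q Q' sB IHB _ IHQ; rewrite !wf_PDefP IHB IHQ.
  by rewrite /closed_decl (scoped_scong sB).
- by move=> P P' Q Q' _ IHP _ IHQ; rewrite !wf_PParP IHP IHQ.
Qed.

End WellFormed.

(** * Progress *)

Section Progress.
Variables (R : realType) (bsort bval : Type).
Notation proc := (proc R bsort bval).
Variable norm : ectx R bsort bval -> proc -> R -> R.
Implicit Types (P Q U : proc).

Lemma wf_step P tl p P' : step norm P tl p P' -> wf_proc P -> wf_proc P'.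
Proof.
elim=> {P tl p P'}.
- move=> s r1 r2 bs bs' l p v P P' _ inP inP' /wf_PParE[/wf_PSelE[_ _ wP] /wf_PBraE[_ wP']].
  by apply: wf_PPar; [exact: wP inP|apply: wf_subst; exact: wP' inP'].
- move=> m n B vs cs Q _ _ /wf_PDefE[cB wB /wf_PParE[_ wQ]].
  by apply: wf_PDef => //; apply: wf_PPar => //; exact: wf_subst.
- move=> E P tl p P' _ IH; elim: E => //=.
  + by move=> E IHE Q /wf_PParE[/IHE ? ?]; exact: wf_PPar.
  + by move=> Q E IHE /wf_PParE[? /IHE ?]; exact: wf_PPar.
  + by move=> oG E IHE /wf_PResE[? /IHE ?]; exact: wf_PRes.
  + by move=> m n B E IHE /wf_PDefE[? ? /IHE ?]; exact: wf_PDef.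
- by move=> P Q tl p Q' P' /wf_scong-> _ IH /wf_scong<-.
Qed.

Definition can_step P := exists tl p Q, step norm P tl p Q.

Lemma can_step_scong P Q : scong P Q -> can_step Q -> can_step P.
Proof.
move=> PQ [tl [p [Q' st]]]; exists tl, p, Q'.
exact: step_struct PQ st (sc_refl _).
Qed.

Lemma can_step_fill E P : can_step P -> can_step (fill E P).
Proof. by move=> [tl [p [P' st]]]; do 3 eexists; exact: step_ctxt st. Qed.

Lemma can_step_par P Q : can_step P -> can_step (PPar P Q).
Proof. exact: (@can_step_fill (EParL EHole Q)). Qed.

Lemma can_step_res oG P : can_step P -> can_step (PRes oG P).
Proof. exact: (@can_step_fill (ERes oG EHole)). Qed.

Lemma can_step_def m n B P : can_step P -> can_step (PDef m n B P).
Proof. exact: (@can_step_fill (EDef m n B EHole)). Qed.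

Lemma sc_def_body m n (B Q Q' : proc) : scong Q Q' -> scong (PDef m n B Q) (PDef m n B Q').
Proof. by move=> QQ'; apply: sc_def QQ'; exact: sc_refl. Qed.

Lemma sc_parL P P' Q : scong P P' -> scong (PPar P Q) (PPar P' Q).
Proof. by move=> h; apply: sc_par h (sc_refl _). Qed.

Lemma sc_parR P Q Q' : scong Q Q' -> scong (PPar P Q) (PPar P Q').
Proof. by move=> h; apply: sc_par (sc_refl _) h. Qed.

Lemma sc_par_def m n B P Q :
  scong (PPar (PDef m n B P) Q) (PDef m n B (PPar P (ren_pvar S Q))).
Proof. exact/sc_sym/sc_def_par. Qed.

(** * Prenex forms *)

Fixpoint flat P : bool :=
  match P with
  | PRes _ _ | PDef _ _ _ _ => false
  | PPar P Q => flat P && flat Q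
  | _ => true
  end.

Inductive prenex : proc -> Prop :=
| prenex_flat P : flat P -> prenex P
| prenex_res oG P : prenex P -> prenex (PRes oG P)
| prenex_def m n B P : prenex P -> prenex (PDef m n B P).

Lemma flat_subst P : flat P -> forall rs se sc rX, flat (subst rs se sc rX P).
Proof. by elim/proc_ind_In: P => //= P Q IHP IHQ /andP[fP fQ] *; rewrite IHP ?IHQ. Qed.

Lemma prenex_subst P : prenex P -> forall rs se sc rX, prenex (subst rs se sc rX P).
Proof.
elim=> {P} [P fP|oG P _ IH|m n B P _ IH] rs se sc rX.
- exact/prenex_flat/flat_subst.
- exact/prenex_res/IH.
- exact/prenex_def/IH.
Qed.

Lemma prenex_par_flat P Q : flat P -> prenex Q -> exists2 U, prenex U & scong (PPar P Q) U.
Proof.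
move=> fP pQ; elim: pQ P fP => {Q} [Q fQ|oG Q _ IH|m n B Q _ IH] P fP.
- by exists (PPar P Q); [apply: prenex_flat; rewrite /= fP|exact: sc_refl].
- have [U pU sU] := IH (ren_sess S P) (flat_subst fP _ _ _ _).
  exists (PRes oG U); first exact: prenex_res.
  apply: sc_trans (sc_par_comm _ _) _; apply: sc_trans (sc_res_par _ _ _) _.
  by apply: sc_res; apply: sc_trans (sc_par_comm _ _) sU.
- have [U pU sU] := IH (ren_pvar S P) (flat_subst fP _ _ _ _).
  exists (PDef m n B U); first exact: prenex_def.
  apply: sc_trans (sc_par_comm _ _) _; apply: sc_trans (sc_par_def _ _ _ _ _) _.
  by apply: sc_def_body; apply: sc_trans (sc_par_comm _ _) sU.
Qed.

Lemma prenex_par P Q : prenex P -> prenex Q -> exists2 U, prenex U & scong (PPar P Q) U.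
Proof.
move=> pP; elim: pP Q => {P} [P fP|oG P _ IH|m n B P _ IH] Q pQ.
- exact: prenex_par_flat.
- have [U pU sU] := IH (ren_sess S Q) (prenex_subst pQ _ _ _ _).
  exists (PRes oG U); first exact: prenex_res.
  by apply: sc_trans (sc_res_par _ _ _) (sc_res _ sU).
- have [U pU sU] := IH (ren_pvar S Q) (prenex_subst pQ _ _ _ _).
  exists (PDef m n B U); first exact: prenex_def.
  by apply: sc_trans (sc_par_def _ _ _ _ _) (sc_def_body _ _ _ sU).
Qed.

Lemma prenex_exists P : exists2 U, prenex U & scong P U.
Proof.
have fl Q : flat Q -> exists2 U, prenex U & scong Q U.
  by move=> fQ; exists Q; [exact: prenex_flat|exact: sc_refl].
elim/proc_ind_In: P => [c r bs _|c r bs _|oG P [U pU sU]|m n B Q _ [U pU sU]|X vs cs||P Q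
  [U pU sU] [V pV sV]]; try exact: fl.
- by exists (PRes oG U); [exact: prenex_res|exact: sc_res].
- by exists (PDef m n B U); [exact: prenex_def|exact: sc_def_body].
- have [W pW sW] := prenex_par pU pV; exists W => //.
  exact: sc_trans (sc_par sU sV) sW.
Qed.

(** * Firing a call *)

Fixpoint has_call P : bool :=
  match P with
  | PCall _ _ _ => true
  | PPar P Q => has_call P || has_call Q
  | PRes _ P | PDef _ _ _ P => has_call P
  | _ => false
  end.

(** The arities are kept because [step_call] demands them once the call meets its declaration. *)
Definition call_front (Gp : decls) P := exists X vs cs Q e,
  [/\ Gp X = Some e, decl_ok (size vs) (size cs) e & scong P (PPar (PCall X vs cs) Q)].

Lemma flat_call Gp P D : flat P -> has_call P -> wt Gp P D -> call_front Gp P.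
Proof.
elim/proc_ind_In: P D => // [X vs cs|P Q IHP IHQ] D /=.
  move=> _ _ /wt_callE[e [eX oke _]]; exists X, vs, cs, PNil, e; split=> //.
  exact/sc_sym/sc_par_nil.
move=> /andP[fP fQ] /orP[cP|cQ] /wt_parE[D1 [D2 [_ wP wQ]]].
  have [X [vs [cs [U [e [eX oke sU]]]]]] := IHP _ fP cP wP.
  exists X, vs, cs, (PPar U Q), e; split=> //.
  exact: sc_trans (sc_parL _ sU) (sc_par_assoc _ _ _).
have [X [vs [cs [U [e [eX oke sU]]]]]] := IHQ _ fQ cQ wQ.
exists X, vs, cs, (PPar U P), e; split=> //.
apply: sc_trans (sc_par_comm _ _) _.
exact: sc_trans (sc_parL _ sU) (sc_par_assoc _ _ _).
Qed.

Definition res_seq (oGs : seq (option (gtype R bsort))) P : proc :=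
  foldr (fun oG Q => PRes oG Q) P oGs.

Lemma sc_res_seq oGs P Q : scong P Q -> scong (res_seq oGs P) (res_seq oGs Q).
Proof. by elim: oGs => //= oG oGs IH /IH; exact: sc_res. Qed.

(** In [step_call] the declaration stands directly above the parallel composition, so the
    restrictions in between have to move out. *)
Lemma sc_def_res_seq m n B oGs P :
  exists B', scong (PDef m n B (res_seq oGs P)) (res_seq oGs (PDef m n B' P)).
Proof.
elim: oGs B => [|oG oGs IH] B /=; first by exists B; exact: sc_refl.
have [B' sB'] := IH (ren_sess S B); exists B'.
exact: sc_trans (sc_def_res _ _ _ _ _) (sc_res _ sB').
Qed.

Lemma can_step_res_seq oGs P : can_step P -> can_step (res_seq oGs P).
Proof. by move=> st; elim: oGs => //= oG oGs; exact: can_step_res. Qed.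

Lemma ren_pvar_call X vs cs :
  ren_pvar S (PCall X vs cs) = PCall X.+1 vs cs :> proc.
Proof.
rewrite /ren_pvar /= subst_chan_id map_id; congr PCall.
by elim: vs => //= v vs ->; rewrite subst_expr_EVar.
Qed.

(** Going outwards from the flat core, restrictions are collected in [oGs], a declaration of another
    variable is moved behind the call, and the declaration of the called variable lets it fire. When
    [Gp] declares nothing, only the firing is possible. *)
Lemma prenex_call Gp P D : prenex P -> has_call P -> wt Gp P D ->
  can_step P \/
  exists oGs Q, call_front Gp Q /\ scong P (res_seq oGs Q).
Proof.
move=> pP; elim: pP Gp D => {P} [P fP|oG P _ IH|m n B P _ IH] Gp D cP.
- move=> wP; right; exists [::], P; split; last exact: sc_refl.
  exact: flat_call fP cP wP.
- move=> /wt_resE[C _ /(IH _ _ cP)[st|[oGs [Q [cQ sQ]]]]].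
    by left; exact: can_step_res.
  by right; exists (oG :: oGs), Q; split=> //; exact: sc_res.
- move=> /wt_defE[oe [ok _ /(IH _ _ cP)[st|[oGs [Q [cQ sQ]]]]]].
    by left; exact: can_step_def.
  have [B' sB'] := sc_def_res_seq m n B oGs Q.
  have sP : scong (PDef m n B P) (res_seq oGs (PDef m n B' Q)).
    exact: sc_trans (sc_def_body _ _ _ sQ) sB'.
  (* Process variable 0 is the one declared by this binder. *)
  case: cQ => [[|X] [vs [cs [U [e [/= eX oke sU]]]]]].
    left; apply: can_step_scong sP _; apply: can_step_res_seq.
    apply: can_step_scong (sc_def_body _ _ _ sU) _.
    have [em en _] := ok e eX; have [ev ec _] := oke; do 3 eexists; apply: step_call.
      by rewrite -ev em.
    by rewrite -ec en.
  right; exists oGs, (PPar (PCall X vs cs) (PDef m n B' U)); split.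
    by exists X, vs, cs, (PDef m n B' U), e; split=> //; exact: sc_refl.
  apply: sc_trans sP _; apply: sc_res_seq.
  apply: sc_trans (sc_def_body _ _ _ sU) _; rewrite -ren_pvar_call.
  apply: sc_trans (sc_def_body _ _ _ (sc_par_comm _ _)) _.
  exact: sc_trans (sc_def_par _ _ _ _ _) (sc_par_comm _ _).
Qed.

(** * Exposing a matching pair of prefixes *)

Definition env_del (c : chan) (D : env) : env :=
  fun c' => if pselect (c' = c) then ltree_nil else D c'.

Definition prefix_at (c : chan) (h : head) P : Prop :=
  (exists r bs, [/\ P = PSel c r bs, bs <> [::] & h = HSel r (unzip1 bs)]) \/
  (exists r bs, [/\ P = PBra c r bs, bs <> [::] & h = HBra r (unzip1 bs)]).

(** In a flat process without calls only prefixes use channels, one each, so a root at [c] comes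
    from an unguarded prefix on [c]. The rest is typed without [c], which allows a second extraction
    for the partner. *)
Lemma flat_prefix Gp P D c h : flat P -> ~~ has_call P -> wt Gp P D ->
  D c [::] = Some h ->
  exists L Q, [/\ prefix_at c h L, flat Q && ~~ has_call Q,
    wt Gp Q (env_del c D) & scong P (PPar L Q)].
Proof.
have del_one c' t : env_del c' (env_one c' t) = env_nil.
  by apply: funext => c0; rewrite /env_del; case: pselect => //= /env_one_neq ->.
have front P0 D0 t c0 : D0 = env_one c0 t -> D0 c [::] = Some h ->
    (t [::] = Some h -> prefix_at c0 h P0) ->
  exists L Q, [/\ prefix_at c h L, flat Q && ~~ has_call Q,
    wt Gp Q (env_del c D0) & scong P0 (PPar L Q)].
  move=> -> eh pre; have ec : c = c0.
    by apply: (@env_one_supp _ t) => e; rewrite e in eh.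
  rewrite -ec env_one_eq in eh; exists P0, PNil; split=> //.
  - by rewrite ec; exact: pre.
  - by rewrite ec del_one; exact: wt_nil.
  - exact/sc_sym/sc_par_nil.
elim/proc_ind_In: P D => //=.
- move=> c0 r bs _ D _ _ /wt_selE[t [e nbs et _]] eh.
  apply: (front _ _ t c0 e eh) => eh'; left; exists r, bs; split=> //.
  by move: eh'; rewrite et => -[].
- move=> c0 r bs _ D _ _ /wt_braE[t [e nbs et _]] eh.
  apply: (front _ _ t c0 e eh) => eh'; right; exists r, bs; split=> //.
  by move: eh'; rewrite et => -[].
- by move=> D _ _ /wt_nilE ->.
- move=> P Q IHP IHQ D /andP[fP fQ]; rewrite negb_or => /andP[cP cQ].
  move=> /wt_parE[D1 [D2 [s wP wQ]]] eh.
  have del E1 E2 : env_split D E1 E2 -> E1 c = D c ->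
      env_split (env_del c D) (env_del c E1) E2.
    move=> sE e c'; rewrite /env_del; case: pselect => [ec|_] /=; last exact: sE.
    rewrite ec; case: (sE c) => -[e1 e2]; first by left.
    by rewrite e1 in e; rewrite -e in eh.
  case: (s c) => -[e1 e2].
    rewrite -e1 in eh; have [L [U [pL /andP[fU cU] wU sU]]] := IHP _ fP cP wP eh.
    exists L, (PPar U Q); split=> //.
    + by rewrite /= fU fQ negb_or cU.
    + by apply: wt_par wU wQ; exact: del.
    + exact: sc_trans (sc_parL _ sU) (sc_par_assoc _ _ _).
  rewrite -e2 in eh; have [L [U [pL /andP[fU cU] wU sU]]] := IHQ _ fQ cQ wQ eh.
  exists L, (PPar U P); split=> //.
  + by rewrite /= fU fP negb_or cU.
  + by apply: wt_par wU wP; apply: del => //; exact: env_split_sym.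
  + apply: sc_trans (sc_par_comm _ _) _.
    exact: sc_trans (sc_parL _ sU) (sc_par_assoc _ _ _).
Qed.

Lemma flat_nil Gp P D : flat P -> ~~ has_call P -> wt Gp P D ->
  scong P PNil \/ exists c h, D c [::] = Some h /\ forall t, h <> HVar t.
Proof.
elim/proc_ind_In: P D => //=.
- move=> c r bs _ D _ _ /wt_selE[t [-> _ et _]]; right.
  by exists c; rewrite env_one_eq et; eexists.
- move=> c r bs _ D _ _ /wt_braE[t [-> _ et _]]; right.
  by exists c; rewrite env_one_eq et; eexists.
- by left; exact: sc_refl.
- move=> P Q IHP IHQ D /andP[fP fQ]; rewrite negb_or => /andP[cP cQ].
  move=> /wt_parE[D1 [D2 [s wP wQ]]].
  case: (IHP _ fP cP wP) => [sP|[c [h [eh nv]]]]; last first.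
    by right; exists c, h; split=> //; case: (s c) => [[<- //]|[e]]; rewrite e in eh.
  case: (IHQ _ fQ cQ wQ) => [sQ|[c [h [eh nv]]]]; last first.
    by right; exists c, h; split=> //; case: (s c) => [[_ e]|[_ <- //]]; rewrite e in eh.
  by left; apply: sc_trans (sc_par sP sQ) (sc_par_nil _).
Qed.

(** Two uses of [flat_prefix] put the prefixes side by side below the binders. The common set [L]
    makes every selected label available in the branching. *)
Lemma prenex_comm Gp P D s a b L : prenex P -> ~~ has_call P -> wt Gp P D ->
  D (CSess s a) [::] = Some (HSel b L) -> D (CSess s b) [::] = Some (HBra a L) ->
  can_step P.
Proof.
move=> pP; elim: pP Gp D s => {P} [P fP|oG P _ IH|m n B P _ IH] Gp D s cP.
- move=> wP ea eb.
  have [L1 [Q [pL1 /andP[fQ cQ] wQ sP]]] := flat_prefix fP cP wP ea.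
  have eb' : env_del (CSess s a) D (CSess s b) [::] = Some (HBra a L).
    rewrite /env_del; case: pselect => //= e.
    by move: eb; rewrite e ea.
  have [L2 [U [pL2 _ _ sQ]]] := flat_prefix fQ cQ wQ eb'.
  case: pL1 => [[r1 [bs1 [e1 n1 [er1 el1]]]]|[? [? []//]]].
  case: pL2 => [[? [? []//]]|[r2 [bs2 [e2 n2 [er2 el2]]]]]; subst r1 r2 L L1 L2.
  have sP' : scong P (PPar (PPar (PSel (CSess s a) b bs1) (PBra (CSess s b) a bs2)) U).
    apply: sc_trans sP _; apply: sc_trans (sc_parR _ sQ) _.
    exact/sc_sym/sc_par_assoc.
  apply: can_step_scong sP' _; apply: can_step_par.
  (* Any label of the selection will do; the first is taken, the family being nonempty. *)
  case: bs1 n1 el2 {sP ea eb eb'} => // -[l [[p v] P1]] bs1 _ el2.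
  have [P2 eP2] : exists P2, assoc l bs2 = Some P2.
    by apply: assoc_unzip1; rewrite -el2 inE eqxx.
  do 3 eexists; apply: step_com; last exact: assoc_In eP2.
    by rewrite el2.
  by left.
- move=> /wt_resE[C _ wP] ea eb; apply: can_step_res.
  exact: IH cP wP (_ : env_res C D (CSess s.+1 a) [::] = _) eb.
- by move=> /wt_defE[oe [_ _ wP]] ea eb; apply: can_step_def; exact: IH cP wP ea eb.
Qed.

(** The third alternative is a free channel that waits for a partner. It does not survive its own
    restriction, where coherence provides a pair that can communicate, and it is impossible in the
    empty environment. *)
Lemma prenex_progress Gp P D : prenex P -> ~~ has_call P -> wf_proc P -> wt Gp P D ->
  [\/ can_step P, scong P PNil |
      exists c h, D c [::] = Some h /\ forall t, h <> HVar t].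
Proof.
move=> pP; elim: pP Gp D => {P} [P fP|oG P pP IH|m n B P _ IH] Gp D cP.
- by move=> _ /(flat_nil fP cP)[]; [constructor 2|constructor 3].
- move=> /wf_PResE[wG wfP] /wt_resE[C cC wP].
  case: (IH _ _ cP wfP wP) => [st|sP|[c [h [eh nv]]]].
  + by constructor 1; exact: can_step_res.
  + by constructor 2; apply: sc_trans (sc_res _ sP) _; exact: sc_res_nil.
  + case: (shift_chanP c) eh => [[r ->] eh|[c' ->]].
      have [a [b [L [ea eb]]]] := coherent_progress cC eh nv.
      constructor 1; apply: can_step_res.
      exact: (prenex_comm (s := 0) pP cP wP ea eb).
    by rewrite env_res_shift => eh; constructor 3; exists c', h.
- move=> /wf_PDefE[cB wB wfP] /wt_defE[oe [_ _ wP]].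
  case: (IH _ _ cP wfP wP) => [st|sP|]; last by constructor 3.
  + by constructor 1; exact: can_step_def.
  + by constructor 2; apply: sc_trans (sc_def_body _ _ _ sP) _; exact: sc_def_nil.
Qed.

Lemma wt_progress P : wf_proc P -> wt (fun=> None) P env_nil ->
  can_step P \/ scong P PNil.
Proof.
have [U pU sU] := prenex_exists P.
rewrite (wf_scong sU) (wt_scong sU) => wfU wU.
case: (boolP (has_call U)) => cU.
  case: (prenex_call pU cU wU) => [st|[oGs [Q [[X [vs [cs [V [e []]]]]] //]]]].
  by left; exact: can_step_scong sU st.
case: (prenex_progress pU cU wfU wU) => [st|sN|[c [h []]]] //.
  by left; exact: can_step_scong sU st.
by right; exact: sc_trans sU sN.
Qed.

Lemma wt_deadlock_free P : wf_proc P -> wt (fun=> None) P env_nil ->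
  deadlock_free norm P.
Proof.
move=> wfP wP P' st; elim: st wfP wP => {P P'} [P|P tl p Q P' st _ IH] wfP wP stuck.
  by case: (wt_progress wfP wP) => // -[tl [p [Q st]]]; case: (stuck tl p Q).
exact: IH (wf_step st wfP) (step_wt_closed st wP) stuck.
Qed.

End Progress.

(** * From the given type system to the invariant *)

Section Conversion.
Variables (R : realType) (bsort bval : Type) (has_sort : bval -> bsort -> Prop).
Notation proc := (proc R bsort bval).
Notation ltype := (ltype R bsort).
Notation typing := (typing R bsort).
Implicit Types (P Q : proc) (D : typing).

Lemma In_zip (A B : Type) (x0 : A) (y0 : B) x y s t : size s = size t ->
  List.In (x, y) (zip s t) <->
  exists2 i, (i < size s)%N & x = nth x0 s i /\ y = nth y0 t i.
Proof.
elim: s t => [|a s IH] [|b t] //=; first by split=> // -[].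
case=> est; have {}IH := IH t est; split.
- case=> [[<- <-]|/IH[i si [-> ->]]]; first by exists 0%N.
  by exists i.+1.
- case=> -[|i] si [ex ey]; first by left; rewrite ex ey.
  by right; apply/IH; exists i.
Qed.

Lemma In_nth (A : Type) (x0 : A) s i : (i < size s)%N -> List.In (nth x0 s i) s.
Proof. by elim: s i => //= x s IH [|i] /= si; [left|right; exact: IH]. Qed.

Lemma NoDup_nth (A : Type) (x0 : A) s i j : List.NoDup s ->
  (i < size s)%N -> (j < size s)%N -> nth x0 s i = nth x0 s j -> i = j.
Proof.
elim: s i j => // x s IH i j nd; inversion nd as [|? ? nx nst]; subst.
case: i j => [|i] [|j] //= si sj e.
- by case: nx; rewrite e; exact: In_nth.
- by case: nx; rewrite -e; exact: In_nth.
- by rewrite (IH i j).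
Qed.

Lemma In_unzip1P (A B : Type) (x : A) (s : seq (A * B)) :
  List.In x (unzip1 s) <-> exists y, List.In (x, y) s.
Proof.
split; elim: s => [|[a b] s IH] //=.
- by case=> [->|/IH[y ys]]; [exists b; left|exists y; right].
- by case.
- by case=> y [[-> _]|ys]; [left|right; apply: IH; exists y].
Qed.

Lemma NoDup_catl (A : Type) (s t : seq A) : List.NoDup (s ++ t) -> List.NoDup s.
Proof.
elim: s => [|x s IH] /= nd; first exact: List.NoDup_nil.
inversion nd as [|? ? nx nst]; subst; apply: List.NoDup_cons; last exact: IH.
by move=> xs; apply/nx/In_cat; left.
Qed.

Lemma NoDup_catr (A : Type) (s t : seq A) : List.NoDup (s ++ t) -> List.NoDup t.
Proof. by elim: s => // x s IH nd; inversion nd; subst; exact: IH. Qed.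

Lemma NoDup_map (A B : Type) (f : A -> B) s : List.NoDup (map f s) -> List.NoDup s.
Proof.
elim: s => [|x s IH] /= nd; first exact: List.NoDup_nil.
inversion nd as [|? ? nx nst]; subst; apply: List.NoDup_cons; last exact: IH.
by move=> xs; apply/nx/In_map; exists x.
Qed.

Lemma family_head (A B : Type) (bs : seq (label * A)) (ts : seq (label * B)) :
  unzip1 bs = unzip1 ts -> wf_family ts ->
  exists l a b, List.In (l, a) bs /\ List.In (l, b) ts.
Proof.
case: bs ts => [|[l a] bs] [|[l' b] ts] //= [<- _] _.
by exists l, a, b; split; left.
Qed.

(** The rules for prefixes do not state disjointness; it is inherited from a branch, and there is
    one because families are nonempty. *)
Lemma has_type_uniq Gb Gp P D : has_type has_sort Gb Gp P D -> disjoint_domains D.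
Proof.
rewrite /disjoint_domains; elim=> {Gb Gp P D} //.
- move=> Gb Gp c r bs ts D e /andP[wts _] _ _ IH _ _.
  have [l [[[p v] P] [[[d S] T] [inP inT]]]] := family_head e wts.
  exact: IH inP inT.
- move=> Gb Gp c r bs ts D e /andP[wts _] _ IH.
  have [l [P [[S T] [inP inT]]]] := family_head e wts.
  exact: IH inP inT.
- move=> Gb Gp G P D rTs _ _ _ _ _; rewrite /unzip1 map_cat => /NoDup_catl.
  by rewrite -map_comp -[_ \o _]/((subst_chan S CVar) \o fst) map_comp => /NoDup_map.
- move=> Gb Gp P D D' DD' _; apply: Permutation.Permutation_NoDup.
  exact: (Permutation.Permutation_map fst DD').
Qed.

(** A channel that no prefix and no call mentions enters a typing only through the [LEnd] part of
    [TEnd] or [TCall]. This empties the sessions restricted inside a thread. *)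
Lemma has_type_unused Gb Gp P D : has_type has_sort Gb Gp P D ->
  forall s r s' q T, only_on s r P -> List.In (CSess s' q, T) D ->
  s' <> s \/ q <> r -> tree T = ltree_nil.
Proof.
have nonly s r s' q : chan_only_on s r (CSess s' q) -> ~ (s' <> s \/ q <> r).
  by move=> /andP[/eqP -> /eqP ->] [].
elim=> {Gb Gp P D}.
- move=> Gb Gp c r0 bs ts D e /andP[wts _] _ _ IH _ _ s r s' q T.
  move=> /andP[cs /all_In obs] [[ec _]|inD] nq.
    by case: (nonly s r s' q) => //; rewrite -ec.
  have [l [[[p v] P] [[[d S] U] [inP inT]]]] := family_head e wts.
  by apply: (IH _ _ _ _ _ _ _ inP inT s r s' q T (obs _ inP)) => //; right.
- move=> Gb Gp c r0 bs ts D e /andP[wts _] _ IH s r s' q T.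
  move=> /andP[cs /all_In obs] [[ec _]|inD] nq.
    by case: (nonly s r s' q) => //; rewrite -ec.
  have [l [P [[S U] [inP inT]]]] := family_head e wts.
  by apply: (IH _ _ _ _ inP inT s r s' q T (obs _ inP)) => //; right.
- by move=> Gb Gp D _ endD s r s' q T _ inD _; rewrite (endD _ _ inD) tree_end.
- move=> Gb Gp P Q D D' _ _ IHP _ IHQ s r s' q T /= /andP[oP oQ] /In_cat[inD|inD] nq.
    exact: IHP oP inD nq.
  exact: IHQ oQ inD nq.
- move=> Gb Gp G P D rTs _ _ _ _ _ IH s r s' q T /= oP inD nq.
  apply: (IH s.+1 r s'.+1 q T oP); last by case: nq => nq; [left; case|right].
  by apply/In_cat; left; apply/In_map; exists (CSess s' q, T).
- by move=> Gb Gp m n B Q Ss Ts D _ _ _ _ _ _ IHQ s r s' q T /= /andP[_ oQ]; exact: IHQ.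
- move=> Gb Gp X Ss Ts vs cs D _ _ ecs _ endD _ s r s' q T /= /all_In oX /In_cat[inD|inz] nq.
    by rewrite (endD _ _ inD) tree_end.
  case: (nonly s r s' q) => //; apply: oX.
  move/(In_zip (CVar 0) LEnd _ _ ecs): inz => [i ics [-> _]].
  by elim: cs i ics {ecs nq} => // c cs IH [|i] /= ics; [left|right; exact: IH].
- move=> Gb Gp P D D' DD' _ IH s r s' q T oP inD.
  by apply: IH oP _;
    exact: Permutation.Permutation_in (Permutation.Permutation_sym DD') inD.
- move=> Gb Gp P c T0 T1 D TT' _ IH s r s' q T oP [[ec <-]|inD] nq.
    by rewrite -(leqv_tree TT'); apply: IH oP _ nq; left; rewrite ec.
  by apply: IH oP _ nq; right.
Qed.

(** Channels of [D] with an empty tree leave no trace in [E], so a typing of many channels can agree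
    with some [env_one c t]. *)
Definition agree D (E : env) : Prop :=
  (forall c T, List.In (c, T) D -> E c = tree T) /\
  (forall c, ~ List.In c (unzip1 D) -> E c = ltree_nil).

(* Only declarations with at most one formal in use are ever called by a process
   that owns a single channel. *)
Definition decl_of (ST : seq bsort * seq ltype) : option decl_type :=
  if pselect (exists k, forall j, j <> k -> tree (nth LEnd ST.2 j) = ltree_nil)
    is left ex
  then let k := projT1 (cid ex) in
    Some (DeclType (size ST.1) (size ST.2) k (tree (nth LEnd ST.2 k)))
  else None.

Definition decls_of (Gp : seq (seq bsort * seq ltype)) : decls :=
  fun X => if onth Gp X is Some ST then decl_of ST else None.

Lemma decls_of_cons ST Gp : decls_of (ST :: Gp) = decls_cons (decl_of ST) (decls_of Gp).
Proof. by apply: funext => -[]. Qed.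

Lemma decl_ofP Ss Ts e : decl_of (Ss, Ts) = Some e ->
  [/\ decl_exprs e = size Ss, decl_chans e = size Ts,
    decl_tree e = tree (nth LEnd Ts (decl_pos e)) &
    forall j, j <> decl_pos e -> tree (nth LEnd Ts j) = ltree_nil].
Proof.
by rewrite /decl_of; case: pselect => // ex [<-] /=; split=> //; case: cid.
Qed.

Lemma decl_of_ok Ss Ts e : decl_of (Ss, Ts) = Some e -> decl_ok (size Ss) (size Ts) e.
Proof.
move=> /decl_ofP[e1 e2 e3 _]; split=> //; rewrite e3.
by case: ltnP => [|h]; [left|right; rewrite nth_default // tree_end].
Qed.

Lemma agree_one c T t D : agree ((c, T) :: D) (env_one c t) -> t = tree T.
Proof. by case=> h _; rewrite -(h c T) ?env_one_eq //; left. Qed.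

Lemma agree_next c T T' t D : disjoint_domains ((c, T) :: D) ->
  agree ((c, T) :: D) (env_one c t) -> agree ((c, T') :: D) (env_one c (tree T')).
Proof.
move=> nd [h1 h2]; inversion nd as [|? ? nc _]; subst; split.
- move=> c' T0 [[<- <-]|inD]; first by rewrite env_one_eq.
  have nc' : c' <> c by move=> e; apply: nc; apply/In_unzip1P; exists T0; rewrite -e.
  by rewrite -(h1 c' T0) ?env_one_neq //; right.
- by move=> c' nin; rewrite env_one_neq // => e; apply: nin; left.
Qed.

(** The channel of a prefix has a tree with a root, so it is the one channel that the thread
    owns. *)
Lemma agree_root c c0 T t h D : agree ((c, T) :: D) (env_one c0 t) ->
  tree T [::] = Some h -> c0 = c.
Proof.
case=> h1 _ eT; have := h1 c T (or_introl erefl).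
case: (pselect (c = c0)) => [//|nc]; rewrite env_one_neq // => e.
by rewrite -e in eT.
Qed.

Lemma agree_cat D D' c t : disjoint_domains (D ++ D') -> agree (D ++ D') (env_one c t) ->
  exists t1 t2, [/\ env_split (env_one c t) (env_one c t1) (env_one c t2),
    agree D (env_one c t1) & agree D' (env_one c t2)].
Proof.
move=> nd [h1 h2].
have in1 c' T : List.In (c', T) D -> env_one c t c' = tree T.
  by move=> inD; apply: h1; apply/In_cat; left.
have in2 c' T : List.In (c', T) D' -> env_one c t c' = tree T.
  by move=> inD; apply: h1; apply/In_cat; right.
case: (pselect (List.In c (unzip1 D))) => inc.
  have nc : ~ List.In c (unzip1 D').
    move: nd inc; rewrite /disjoint_domains /unzip1 map_cat.
    elim: (map fst D) => //= x s IH nd; inversion nd as [|? ? nx nst]; subst.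
    case=> [ec|]; last exact: IH.
    by move=> cD; apply/nx/In_cat; right; rewrite ec.
  exists t, ltree_nil; split.
  - by rewrite env_one_nil; exact: env_split_nilr.
  - split=> // c' nin; rewrite env_one_neq // => e; by rewrite e in nin.
  - rewrite env_one_nil; split=> // c' T inT.
    rewrite -(in2 _ _ inT) env_one_neq // => e; apply: nc.
    by apply/In_unzip1P; exists T; rewrite -e.
exists ltree_nil, t; split.
- by rewrite env_one_nil; apply/env_split_sym; exact: env_split_nilr.
- rewrite env_one_nil; split=> // c' T inT.
  rewrite -(in1 _ _ inT) env_one_neq // => e; apply: inc.
  by apply/In_unzip1P; exists T; rewrite -e.
- split=> // c' nin; case: (pselect (c' = c)) => [e|ne]; last by rewrite env_one_neq.
  by apply: h2; rewrite /unzip1 map_cat => /In_cat[]; rewrite ?e // -?e.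
Qed.

Lemma env_res_one c t :
  env_res (fun=> ltree_nil) (env_one c t) = env_one (shift_chan c) t.
Proof.
apply: funext => c'; case: (shift_chanP c') => [[q ->]|[c0 ->]].
  by rewrite env_one_neq //; case: c.
rewrite env_res_shift; case: (pselect (c0 = c)) => [->|ne]; first by rewrite !env_one_eq.
by rewrite !env_one_neq // => /shift_chan_inj.
Qed.

(** An inner restriction is typed by the empty family, because [only_on] forbids the use of its
    channels. A declaration with several formals in use is given [None] and its body is not
    translated; the case of [TCall] shows that the owner of a single channel never calls it. *)
Lemma has_type_wt Gb Gp P D : has_type has_sort Gb Gp P D ->
  forall s r c t, only_on s r P -> agree D (env_one c t) ->
  wt (decls_of Gp) P (env_one c t).
Proof.
elim=> {Gb Gp P D}.
- move=> Gb Gp c r0 bs ts D e /andP[wts wts'] _ hP IH _ _ s r c0 t /= /andP[oc /all_In ob] ag.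
  have ec := agree_root ag (tree_sel_root _ _); subst c0.
  have et := agree_one ag; subst t.
  have [l0 [[[p0 v0] P0] [[[d0 S0] T0] [inP0 inT0]]]] := family_head e wts.
  have nd := has_type_uniq (hP _ _ _ _ _ _ _ inP0 inT0).
  apply: wt_sel.
  + by move=> bs0; rewrite bs0 in inP0.
  + by rewrite tree_sel_root e.
  + move=> l [p v] P inP; have := In_unzip1 inP; rewrite e => /assoc_unzip1[[[d S] T] eT].
    rewrite (tree_sel_at _ eT); apply: (IH _ _ _ _ _ _ _ inP (assoc_In eT) s r) (ob _ inP) _.
    exact: (@agree_next _ (LSel r0 ts) _ _ D nd ag).
- move=> Gb Gp c r0 bs ts D e /andP[wts wts'] hP IH s r c0 t /= /andP[oc /all_In ob] ag.
  have ec := agree_root ag (tree_bra_root _ _); subst c0.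
  have et := agree_one ag; subst t.
  have [l0 [P0 [[S0 T0] [inP0 inT0]]]] := family_head e wts.
  have nd := has_type_uniq (hP _ _ _ _ inP0 inT0).
  apply: wt_bra.
  + by move=> bs0; rewrite bs0 in inP0.
  + by rewrite tree_bra_root e.
  + move=> l P inP; have := In_unzip1 inP; rewrite e => /assoc_unzip1[[S T] eT].
    rewrite (tree_bra_at _ eT); apply: (IH _ _ _ _ inP (assoc_In eT) s r) (ob _ inP) _.
    exact: (@agree_next _ (LBra r0 ts) _ _ D nd ag).
- move=> Gb Gp D _ endD s r c t _ [h1 h2]; suff -> : env_one c t = env_nil by exact: wt_nil.
  apply: funext => c'; case: (pselect (List.In c' (unzip1 D))) => [|/h2->//].
  by move/In_unzip1P => [T inT]; rewrite (h1 _ _ inT) (endD _ _ inT) tree_end.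
- move=> Gb Gp P Q D D' nd _ IHP _ IHQ s r c t /= /andP[oP oQ] ag.
  have [t1 [t2 [sp ag1 ag2]]] := agree_cat nd ag.
  by apply: wt_par sp _ _; [exact: IHP oP ag1|exact: IHQ oQ ag2].
- move=> Gb Gp G P D rTs _ _ _ _ hP IH s r c t /= oP [h1 h2].
  apply: (wt_res _ coherent_nil); rewrite env_res_one; apply: (IH _ _ _ _ oP).
  rewrite -env_res_one; split.
  + move=> c' T /In_cat[/In_map[[c0 T'] inD /= [-> ->]]|/In_map[[q T'] inT /= [-> ->]]].
      by rewrite -/shift_chan env_res_shift; exact: h1.
    rewrite /=; apply/esym; apply: (has_type_unused hP oP (q := q) (s' := 0%N)); last by left.
    by apply/In_cat; right; apply/In_map; exists (q, T').
  + move=> c' nin; case: (shift_chanP c') nin => [[q ->]//|[c0 ->]] nin.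
    rewrite env_res_shift; apply: h2 => inc; apply: nin.
    rewrite /unzip1 map_cat; apply/In_cat; left; rewrite -map_comp.
    move/In_unzip1P: inc => [T inT]; apply/In_map; by exists (c0, T).
- move=> Gb Gp m n B Q Ss Ts D eSs eTs _ _ IHB _ IHQ s r c t /= /andP[oB oQ] ag.
  rewrite !decls_of_cons in IHB IHQ; subst m n.
  apply: (wt_def (oe := decl_of (Ss, Ts))); [exact: decl_of_ok| |exact: IHQ oQ ag].
  move=> e ee; apply: IHB oB _; have [_ _ -> zero] := decl_ofP ee; split.
  + move=> c' T /(In_zip (CVar 0) LEnd); rewrite size_map size_iota => /(_ erefl)[i iT [-> ->]].
    rewrite (nth_map 0%N) ?size_iota // nth_iota //.
    case: (eqVneq i (decl_pos e)) => [->|/eqP ne]; first by rewrite env_one_eq.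
    by rewrite (zero i ne) env_one_neq // => -[/ne].
  + move=> c' nin; case: (pselect (c' = CVar (decl_pos e))) => [ec|]; last exact: env_one_neq.
    rewrite ec env_one_eq nth_default ?tree_end // leqNgt; apply/negP => lt; apply: nin.
    apply/In_unzip1P; exists (nth LEnd Ts (decl_pos e)).
    apply/(In_zip (CVar 0) LEnd); rewrite size_map size_iota //.
    by exists (decl_pos e) => //; rewrite (nth_map 0%N) ?size_iota // nth_iota.
- move=> Gb Gp X Ss Ts vs cs D eX evs ecs _ endD nd s r c t _ [h1 h2].
  have inz j : (j < size Ts)%N -> List.In (nth (CVar 0) cs j, nth LEnd Ts j) (zip cs Ts).
    by move=> jT; apply/(In_zip (CVar 0) LEnd _ _ ecs); exists j; rewrite ?ecs.
  have hz j : (j < size Ts)%N -> env_one c t (nth (CVar 0) cs j) = tree (nth LEnd Ts j).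
    by move=> jT; apply: h1; apply/In_cat; right; exact: inz.
  have uniq_cs i j : (i < size Ts)%N -> (j < size Ts)%N ->
      nth (CVar 0) cs i = nth (CVar 0) cs j -> i = j.
    rewrite -ecs; apply: NoDup_nth; move: nd.
    rewrite /disjoint_domains /unzip1 map_cat => /NoDup_catr.
    by rewrite -/(unzip1 _) unzip1_zip ?ecs.
  (* The formal in use is the one that receives [c], unique because the arguments are distinct. If
     [c] is not passed, all formals have empty trees and position 0 is as good as any. *)
  have [e ee] : exists e, decl_of (Ss, Ts) = Some e.
    rewrite /decl_of; case: pselect => [ex|[]]; first by eexists.
    case: (pselect (exists2 k, (k < size Ts)%N & nth (CVar 0) cs k = c)) => [[k kT ek]|nk].
      exists k => j jk /=; case: (ltnP j (size Ts)) => jT; last by rewrite nth_default ?tree_end.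
      by rewrite -hz // env_one_neq // -ek => /uniq_cs => /(_ jT kT).
    exists 0%N => j _ /=; case: (ltnP j (size Ts)) => jT; last by rewrite nth_default ?tree_end.
    by rewrite -hz // env_one_neq // => e; apply: nk; exists j.
  have [e1 e2 e3 zero] := decl_ofP ee.
  suff -> : env_one c t = env_one (nth (CVar 0) cs (decl_pos e)) (decl_tree e).
    apply: wt_call; first by rewrite /decls_of eX.
    by rewrite evs ecs; exact: decl_of_ok.
  apply: funext => c'.
  case: (pselect ((decl_pos e < size Ts)%N /\ c' = nth (CVar 0) cs (decl_pos e))) => [[kT ->]|nc].
    by rewrite hz // env_one_eq.
  have -> : env_one (nth (CVar 0) cs (decl_pos e)) (decl_tree e) c' = ltree_nil.
    case: (ltnP (decl_pos e) (size Ts)) => kT.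
      by rewrite env_one_neq // => ec; apply: nc.
    by rewrite e3 [nth LEnd _ _]nth_default // tree_end env_one_nil.
  case: (pselect (List.In c' (unzip1 (D ++ zip cs Ts)))) => [|/h2//].
  move=> /In_unzip1P[T inT]; rewrite (h1 _ _ inT).
  case/In_cat: inT => [inD|]; first by rewrite (endD _ _ inD) tree_end.
  move/(In_zip (CVar 0) LEnd _ _ ecs) => [j jT [ec ->]].
  by apply: zero => ej; apply: nc; rewrite -ej -ecs.
- move=> Gb Gp P D D' DD' _ IH s r c t oP [h1 h2]; apply: IH oP _; split.
  + by move=> c' T inT; apply: h1; exact: Permutation.Permutation_in DD' inT.
  + move=> c' nin; apply: h2 => inc; apply: nin; move: inc.
    apply: Permutation.Permutation_in; apply: Permutation.Permutation_sym.
    exact: (Permutation.Permutation_map fst DD').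
- move=> Gb Gp P c T T' D TT' _ IH s r c0 t oP [h1 h2]; apply: IH oP _; split=> //.
  move=> c' T0 [[<- <-]|inT]; first by rewrite (leqv_tree TT'); apply: h1; left.
  by apply: h1; right.
Qed.

End Conversion.

(** * Deadlock freedom *)

Section Threads.
Variables (R : realType) (bsort bval : Type) (I : finType).
Variables (r : I -> role) (r_inj : injective r) (t : I -> ltree).

(** Injectivity of [r] makes the picked index unique; the restriction to [s] serves the induction
    over the parallel composition. *)
Definition thread_tree (s : seq I) (q : role) : ltree :=
  if [pick i | (r i == q) && (i \in s)] is Some i then t i else ltree_nil.

Lemma thread_treeT s i : i \in s -> thread_tree s (r i) = t i.
Proof.
move=> is_; rewrite /thread_tree; case: pickP => [j /andP[/eqP/r_inj -> //]|/(_ i)].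
by rewrite eqxx is_.
Qed.

Lemma thread_treeF s q : (forall i, r i = q -> i \notin s) -> thread_tree s q = ltree_nil.
Proof.
move=> ns; rewrite /thread_tree; case: pickP => [j /andP[/eqP/ns jq js]|//].
by rewrite js in jq.
Qed.

Lemma wt_big_par (Gp : decls) (Ps : I -> proc R bsort bval) s : uniq s ->
  (forall i, wt Gp (Ps i) (env_one (CSess 0 (r i)) (t i))) ->
  wt Gp (\big[@PPar R bsort bval/PNil]_(i <- s) Ps i) (env_res (thread_tree s) env_nil).
Proof.
move=> us wPs; elim: s us => [|i s IH] us.
  rewrite big_nil; suff -> : env_res (thread_tree [::]) env_nil = env_nil by exact: wt_nil.
  by apply: funext => -[|[|]] //= q; rewrite thread_treeF.
rewrite big_cons; move: us => /= /andP[is_ us].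
apply: wt_par (wPs i) (IH us) => -[j|[|k] q] /=; try by left; rewrite env_one_neq.
case: (eqVneq q (r i)) => [->|nq].
  left; rewrite env_one_eq thread_treeT ?inE ?eqxx //; split=> //.
  by apply: thread_treeF => j /r_inj ->.
right; rewrite env_one_neq; last by case=> e; rewrite e eqxx in nq.
split=> //; congr (if _ is Some i then t i else ltree_nil); apply: eq_pick => j /=.
by rewrite inE; case: eqP => //= e; case: eqP => //= ji; move: nq; rewrite -e ji eqxx.
Qed.

End Threads.

Theorem theorem4 (R : realType) (bsort bval : Type)
    (has_sort : bval -> bsort -> Prop)
    (norm : ectx R bsort bval -> proc R bsort bval -> R -> R)
    (norm_prob : forall E Q p, 0 <= p <= 1 -> 0 <= norm E Q p <= 1)
    (P : proc R bsort bval) (G : gtype R bsort)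
    (I : finType) (r : I -> role) (T : I -> ltype R bsort)
    (Ps : I -> proc R bsort bval) :
  wf_proc P ->
  wf_gtype G ->
  has_type has_sort [::] [::] P [::] ->
  scong P (PRes (Some G) (\big[@PPar R bsort bval/PNil]_(i : I) Ps i)) ->
  injective r ->
  (forall q, (q \in roles G) = [exists i, r i == q]) ->
  (forall i, proj G (r i) (T i)) ->
  (forall i, has_type has_sort [::] [::] (Ps i) [:: (CSess 0 (r i), T i)]) ->
  (forall i, only_on 0 (r i) (Ps i)) ->
  deadlock_free norm P.
Proof.
move=> wfP _ _ PG r_inj rG pT tPs oPs; apply: wt_deadlock_free => //.
rewrite (wt_scong PG); set t := fun i => tree (T i).
have inI i : i \in index_enum I by exact: mem_index_enum.
(* Over all indices, [thread_tree] is the family of projections of [G], because [r] enumerates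
   exactly its roles. *)
apply: (@wt_res _ _ _ _ _ _ (thread_tree r t (index_enum I))).
  apply: (coherent_proj (G := G)) => q; rewrite rG.
    by case/existsP => i /eqP <-; exists (T i) => //; rewrite thread_treeT.
  by move/existsPn => nq; apply: thread_treeF => i /eqP; rewrite (negPf (nq i)).
apply: wt_big_par => //; first exact: index_enum_uniq.
move=> i; have -> : (fun=> None) = @decls_of R bsort [::].
  by apply: funext => X; rewrite /decls_of onth0n.
apply: has_type_wt (tPs i) _ _ _ _ (oPs i) _; split.
  by move=> c T' [[<- <-]|//]; rewrite env_one_eq.
by move=> c nc; rewrite env_one_neq // => e; apply: nc; left.
Qed.
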